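(* Let $1<p<\infty$ and let $w$ be a weight in $X$. Assume that there exists a constant $C_1$ such that \[ \int_{X} \bigl(M^{*} f(x)\bigr)^p w(x)\,d\mu(x) \le C_1 \int_{X}\lvert f(x)\rvert^p w(x)\,d\mu(x) \] for all $f\in L^p(w\,d\mu)$. Then there exist constants $\varepsilon=\varepsilon(c_\mu,p,C_1)$ and $C=C(c_\mu,p,C_1)$ such that $0<\varepsilon<p-1$ and \[ \int_{X} \bigl(M^{*} f(x)\bigr)^{p-\varepsilon} w(x)\,d\mu(x) \le C\int_{X} f(x)^{p-\varepsilon} w(x)\,d\mu(x) \] for all nonnegative $f\in L^\infty(X)$ with a bounded support.
   Context: $X=(X,d,\mu)$ is a metric measure space with a metric $d$ and a positive complete Borel measure $\mu$ such that $0<\mu(B)<\infty$ for all open balls $B=B(x,r)=\{y\in X: d(y,x)<r\}$, $x\in X$, $r>0$. All balls are such open balls. It is assumed that $X$ has at least two points and that $\mu$ is doubling: there is a constant $c_\mu>1$ with $\mu(B(x,2r))\le c_\mu\,\mu(B(x,r))$ for all $x\in X$, $r>0$. A measurable function $w\colon X\to\mathbb{R}$ is a weight in $X$ if $w$ is integrable (with respect to $\mu$) on all balls of $X$ and $w(x)>0$ for almost every $x\in X$. For $1\le p<\infty$, $L^p(w\,d\mu)$ is the set of measurable functions $f$ on $X$ with $\int_X |f|^p w\,d\mu<\infty$. $L^\infty(X)$ denotes the $\mu$-essentially bounded functions. A function has a bounded support if $\{x\in X: f(x)\neq 0\}$ is contained in some ball of $X$. The noncentered Hardy--Littlewood maximal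 function of a measurable function $f$ is \[ M^{*}f(x)=\sup_{B\ni x}\frac{1}{\mu(B)}\int_B |f(y)|\,d\mu(y), \] where the supremum is over all balls $B$ in $X$ containing $x$. The notation $C=C(a,b,\dots)$ means that the constant depends only on the listed parameters. *)

(* Defs.v *)
From HB Require Import structures.
From mathcomp Require Import all_boot all_order all_algebra.
From mathcomp Require Import all_classical all_reals all_analysis.

Set Implicit Arguments.
Unset Strict Implicit.
Unset Printing Implicit Defensive.

Import Order.TTheory GRing.Theory Num.Theory.

Local Open Scope classical_set_scope.
Local Open Scope ring_scope.
Local Open Scope ereal_scope.

(* The two structures are unrelated at this point; [complete_Borel_measure]
   below is what ties the sigma-algebra to the topology. *)
#[short(type="metricMeasurableType")]
HB.structure Definition MetricMeasurable (d : measure_display) (R : realType) :=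
  {T of Metric R T & Measurable d T}.

Section metric_measure_space.
Context (d : measure_display) (R : realType) (X : metricMeasurableType d R).
Implicit Types (mu : {measure set X -> \bar R}) (f w : X -> R) (q : R).

Definition Borel_set (A : set X) : Prop := <<s [set U : set X | open U] >> A.

(* The sigma-algebra of [X] is exactly the completion with respect to [mu] of
   the Borel sigma-algebra.  It is not enough to ask that Borel sets be
   measurable and that [mu] be complete: this would allow measurable sets that
   do not agree with any Borel set up to a null set. *)
Definition complete_Borel_measure mu : Prop :=
  forall A : set X, measurable A <->
    exists B Z : set X, [/\ Borel_set B, Borel_set Z, mu Z = 0,
      B `<=` A & A `\` B `<=` Z].

Definition balls_pos_finite mu : Prop :=
  forall (x : X) (r : R), (0 < r)%R -> 0 < mu (ball x r) < +oo.

Definition doubling mu (c : R) : Prop :=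
  forall (x : X) (r : R), (0 < r)%R ->
    mu (ball x (2 * r)%R) <= c%:E * mu (ball x r).

Definition weight mu w : Prop :=
  [/\ measurable_fun [set: X] w,
      forall (x : X) (r : R), (0 < r)%R ->
        mu.-integrable (ball x r) (EFin \o w) &
      {ae mu, forall x, (0 < w x)%R}].

Definition average mu f (A : set X) : \bar R :=
  (mu A)^-1 * \int[mu]_(y in A) `|f y|%:E.

Definition noncentered_maximal mu f (x : X) : \bar R :=
  ereal_sup [set a | exists (z : X) (r : R),
    [/\ (0 < r)%R, ball z r x & a = average mu f (ball z r)]].

Definition weighted_Lp mu w q f : Prop :=
  measurable_fun [set: X] f /\
  \int[mu]_x (`|f x| `^ q * w x)%:E < +oo.

Definition bounded_support f : Prop :=
  exists (z : X) (r : R), (0 < r)%R /\ [set x | f x != 0%R] `<=` ball z r.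

End metric_measure_space.

(* Main.v *)
Require Import Defs.
From HB Require Import structures.
From mathcomp Require Import all_boot all_order all_algebra.
From mathcomp Require Import all_classical all_reals all_analysis.
From mathcomp Require Import measurable_realfun lra ring.

Set Implicit Arguments.
Unset Strict Implicit.
Unset Printing Implicit Defensive.

Import Order.TTheory GRing.Theory Num.Theory.

Local Open Scope classical_set_scope.
Local Open Scope ring_scope.
Local Open Scope ereal_scope.

(** Why the bound self-improves.  Write [q = p - eps = p / (1 + delta)] with
    [delta] small, and [h = f ^ (1 / (1 + delta))], so that [h ^ p = f ^ q] and
    [f = h * h ^ delta].  Only bounded [f] occur, hence all maximal functions
    are real valued; [hl mu g] denotes the maximal function [M g] of such a [g].

    The iteration [G_0 = 0], [G_(n+1) = h + b * M G_n], with [b] small in terms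
    of [C1], is a Rubio de Francia algorithm.  The assumed bound gives
    [int G_n ^ p w <= 2 ^ (p + 1) * int h ^ p w] ([wint_maximal_iter]).  Since
    [M] does not increase the uniform distance, [G_(n+1) - G_n <= b ^ n * N]
    with [N] a bound of [h], so [G_n] dominates [b * M G_n] up to an error that
    tends to zero: with [eta = b ^ n * N], the function [E = G_(n+1) + eta]
    satisfies [M E <= K * E] with [K = 1/b + 1] ([maximal_iter_A1]).  In other
    words [E] is an A_1 weight whose constant depends on [C1] only.

    An A_1 weight satisfies a reverse Hoelder inequality: the average of
    [E * (M E) ^ delta] over a ball is at most a constant times the value of
    [(M E) ^ (1 + delta)] at any point of the ball, as soon as [delta] is small
    in terms of the doubling constant and [K] ([reverse_Holder]).  Because
    [h <= C * M h] almost everywhere ([ae_le_hl]) and [h <= E], the function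
    [f = h * h ^ delta] is at most [C * E * (M E) ^ delta] almost everywhere,
    and therefore [M f <= C * (G_(n+1) + eta) ^ (1 + delta)] everywhere
    ([hl_powR_le_iter]).  The power [q] of this inequality, integrated against
    [w], gives the theorem when [n] tends to infinity ([wint_hl_le]).

    The geometry of the space enters through the Vitali covering theorem, in
    the form of [integral_le_of_covering].  It yields the estimate of [E] on the
    superlevel sets of [M E] from which the reverse Hoelder inequality follows
    ([integral_level_set]), and, with the outer regularity of the measure, the
    bound [h <= C * M h], a weak substitute for Lebesgue differentiation whose
    constant is larger than 1. *)

(** * Covering by balls *)

Section vitali.
Context (R : realType) (T : pseudoMetricType R) (I : Type).
Variables (V : set I) (z : I -> T) (r : I -> R) (r0 : R).
Hypothesis r_bound : forall i, V i -> (0 < r i <= r0)%R.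

Let B i := ball (z i) (r i).

Let subset5 i j : (r i <= 2 * r j)%R -> B i `&` B j !=set0 ->
  B i `<=` ball (z j) (5 * r j)%R.
Proof.
move=> rij [y [iy jy]] x ix.
apply: (@le_ball _ _ _ (r j + (r i + r i))%R); first by lra.
apply: ball_triangle jy _; apply: ball_triangle ix; exact: ball_sym.
Qed.

(** A maximal disjoint subfamily need not work, since its balls may be much
    smaller than the balls that they meet.  Zorn's lemma is therefore applied to
    the disjoint subfamilies that are dominant: each ball of the whole family
    that meets the subfamily meets one of its balls of at least half its
    radius.  If some balls miss a maximal dominant subfamily, adding one of
    nearly largest radius among them keeps it dominant. *)
Lemma vitali_covering : exists D : set I, [/\ D `<=` V, trivIset D B &
  forall i, V i -> exists2 j, D j & B i `<=` ball (z j) (5 * r j)%R].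
Proof.
pose dominant (D : set I) := [/\ D `<=` V, trivIset D B &
  forall i j, V i -> D j -> B i `&` B j !=set0 ->
    exists k, [/\ D k, B i `&` B k !=set0 & (r i <= 2 * r k)%R]].
have [|D [[DV tD domD] maxD]] := @Zorn_bigcup _ dominant.
  move=> F Fdom Ftot; split.
  - by move=> i [X FX Xi]; have [+ _ _] := Fdom _ FX; exact.
  - move=> i j [X FX Xi] [Y FY Yj].
    have [XY|YX] := Ftot _ _ FX FY.
    + by have [_ tY _] := Fdom _ FY; apply: tY => //; exact: XY.
    + by have [_ tX _] := Fdom _ FX; apply: tX => //; exact: YX.
  - move=> i j Vi [X FX Xj] ij; have [_ _ domX] := Fdom _ FX.
    have [k [Xk ik rik]] := domX _ _ Vi Xj ij.
    by exists k; split => //; exists X.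
have meetsD i : V i -> exists2 j, D j & B i `&` B j !=set0.
  move=> Vi; apply: contrapT => noD.
  pose W := [set k | V k /\ forall j, D j -> ~ (B k `&` B j !=set0)].
  have Wi : W i by split=> // j Dj ij; apply: noD; exists j.
  have supW : has_sup (r @` W).
    split; first by exists (r i), i.
    by exists r0 => _ [k [Vk _] <-]; have /andP[] := r_bound Vk.
  have ri0 : (0 < r i)%R by have /andP[] := r_bound Vi.
  have sup_gt0 : (0 < sup (r @` W))%R.
    by apply: (lt_le_trans ri0); apply: ub_le_sup (supW.2) _ _; exists i.
  have [_ [k Wk <-] rk] := sup_adherent (divr_gt0 sup_gt0 (ltr0Sn R 1)) supW.
  have {}rk j : W j -> (r j <= 2 * r k)%R.
    move=> Wj; have : (r j <= sup (r @` W))%R.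
      by apply: ub_le_sup (supW.2) _ _; exists j.
    by move: rk; lra.
  have rk0 : (0 < r k)%R by have /andP[] := r_bound Wk.1.
  have kk : B k `&` B k !=set0 by rewrite setIid; exists (z k); exact: ballxx.
  apply: (maxD (D `|` [set k])).
    split; first exact: subsetUl.
    by move=> Dk; apply: (Wk.2 k) kk; apply: Dk; right.
  split.
  - by move=> j [/DV//|->]; exact: Wk.1.
  - move=> a b [Da|->] [Db|->] //; first exact: tD.
    + by rewrite setIC => /(Wk.2 _ Da).
    + by move=> /(Wk.2 _ Db).
  - move=> a b Va [Db|->] ab.
      by have [c [Dc ac rac]] := domD _ _ Va Db ab; exists c; split => //; left.
    have [[j Dj aj]|aD] := pselect (exists2 j, D j & B a `&` B j !=set0).
      by have [c [Dc ac rac]] := domD _ _ Va Dj aj; exists c; split => //; left.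
    exists k; split => //; first by right.
    by apply: rk; split=> // j Dj aj; apply: aD; exists j.
exists D; split => // i Vi.
have [j Dj ij] := meetsD i Vi.
have [k [Dk ik rik]] := domD _ _ Vi Dj ij.
by exists k => //; exact: subset5.
Qed.

End vitali.

Section measure_lemmas.
Import finmap.
Context d (T : measurableType d) (R : realType).
Variable mu : {measure set T -> \bar R}.

Lemma le_measure_subset (A B : set T) : measurable A -> measurable B ->
  A `<=` B -> mu A <= mu B.
Proof. by move=> mA mB; apply: le_measure; exact/mem_set. Qed.

Lemma trivIset_pos_countable (I : choiceType) (D : set I) (F : I -> set T)
    (U : set T) :
  trivIset D F -> measurable U -> mu U < +oo ->
  (forall i, D i -> [/\ measurable (F i), F i `<=` U & 0 < mu (F i)]) ->
  countable D.
Proof.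
move=> tF mU Uoo HF.
have finU : mu U \is a fin_num by rewrite ge0_fin_numE.
pose E n := [set i | D i /\ (n.+1%:R^-1)%:E <= mu (F i)].
have DE : D = \bigcup_n E n.
  apply/seteqP; split=> [i Di|i [n _ []]//].
  have [mF FU F0] := HF i Di.
  have finF : mu (F i) \is a fin_num.
    by rewrite ge0_fin_numE// (le_lt_trans _ Uoo)// le_measure//; exact/mem_set.
  have : (0 < fine (mu (F i)))%R by rewrite fine_gt0// F0 -ge0_fin_numE.
  move=> /ltr_add_invr[n]; rewrite add0r => nF.
  by exists n => //; split => //; rewrite -(fineK finF) lee_fin ltW.
rewrite DE; apply: bigcup_countable => // n _; apply: finite_set_countable.
apply: contrapT => infE.
have [k kU] : exists k : nat, (fine (mu U) < k%:R * n.+1%:R^-1)%R.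
  exists (Num.truncn (fine (mu U) * n.+1%:R)).+1.
  by rewrite ltr_pdivlMr// truncnS_gt.
have [A AE kA] := infinite_set_fset k infE.
have tA : trivIset [set` A] F.
  by move=> i j Ai Aj; apply: tF; [exact: (AE _ Ai).1|exact: (AE _ Aj).1].
have mA i : [set` A] i -> measurable (F i).
  by move=> /AE[/HF[]].
have : mu (\bigcup_(i in [set` A]) F i) <= mu U.
  apply: le_measure_subset => //; first exact: fin_bigcup_measurable.
  by move=> x [i /AE[/HF[_ FU _] _] /FU].
rewrite measure_fin_bigcup//; apply/negP; rewrite -ltNge.
apply: (@lt_le_trans _ _ (\sum_(i \in [set` A]) (n.+1%:R^-1)%:E)); last first.
  by apply: lee_fsum => // i /AE[].
rewrite fsbig_finite// set_fsetK sumEFin -(fineK finU) lte_fin.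
rewrite big_const_seq count_predT iter_addr_0 (lt_le_trans kU)//.
by rewrite -[leRHS]mulr_natl ler_wpM2r// ?invr_ge0// ler_nat.
Qed.

End measure_lemmas.

Lemma metric_ball_open (R : realType) (T : metricType R) (x : T) (r : R) :
  open (ball x r).
Proof.
rewrite openE => y; rewrite ballEmdist /= => xy.
apply/nbhs_ballP; exists (r - mdist x y)%R => /=; first by rewrite subr_gt0.
move=> t; rewrite !ballEmdist /= ltrBrDl; apply: le_lt_trans.
exact: metric_triangle.
Qed.

Section covering.
Context (d : measure_display) (R : realType) (X : metricMeasurableType d R).
Variable mu : {measure set X -> \bar R}.
Hypothesis mu_Borel : complete_Borel_measure mu.
Hypothesis mu_ball : balls_pos_finite mu.

Lemma complete_Borel_open (U : set X) : open U -> measurable U.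
Proof.
move=> oU; apply/mu_Borel; exists U, set0; split => //.
- exact: sub_sigma_algebra.
- exact: sigma_algebra0.
- by rewrite setDv.
Qed.

Lemma complete_Borel_ball (x : X) (r : R) : measurable (ball x r).
Proof. apply: complete_Borel_open; exact: metric_ball_open. Qed.

(** The hypothesis compares [g] on the balls of radius [5 r] with the measure of
    the balls of radius [r], because Vitali's theorem makes the latter disjoint
    while the former cover [E]. *)
Lemma integral_le_of_covering (g : X -> R) (E U : set X) (s r0 : R) :
  measurable_fun setT g -> (forall x, 0 <= g x)%R -> (0 <= s)%R ->
  measurable E -> measurable U -> mu U < +oo ->
  (forall y, E y -> exists z r, [/\ (0 < r <= r0)%R, ball z r y,
    ball z r `<=` U &
    \int[mu]_(x in E `&` ball z (5 * r)%R) (g x)%:E <= s%:E * mu (ball z r)]) ->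
  \int[mu]_(x in E) (g x)%:E <= s%:E * mu U.
Proof.
move=> mg g0 s0 mE mU Uoo cov.
pose good y (p : X * R) := E y -> [/\ (0 < p.2 <= r0)%R, ball p.1 p.2 y,
  ball p.1 p.2 `<=` U &
  \int[mu]_(x in E `&` ball p.1 (5 * p.2)%R) (g x)%:E
    <= s%:E * mu (ball p.1 p.2)].
have [f fP] : {f & forall y, good y (f y)}.
  apply: choice => y; have [Ey|nEy] := pselect (E y); last by exists (y, 0%R).
  by have [z [r H]] := cov y Ey; exists (z, r).
pose B i := ball (f i).1 (f i).2.
pose B5 i := ball (f i).1 (5 * (f i).2)%R.
have [|D [DE tD coverD]] := @vitali_covering _ X X E (fst \o f) (snd \o f) r0.
  by move=> i /fP[].
have mB i : measurable (B i) by exact: complete_Borel_ball.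
have mB5 i : measurable (B5 i) by exact: complete_Borel_ball.
have cD : countable D.
  apply: (@trivIset_pos_countable _ _ _ mu _ D B U) => // i.
  move=> /DE/fP[/andP[r_gt0 _] _ BU _].
  by split => //; have /andP[] := mu_ball (f i).1 r_gt0.
(* The selected balls are indexed by [nat] through an injection [e]; the sets
   [A n] and [C n] are empty when [n] is not in the range of [e]. *)
have /countable_injP[e einj] := cD.
pose Dn n := D `&` [set i | e i = n].
have Dn01 n : Dn n = set0 \/ exists2 i, D i & Dn n = [set i].
  have [[i [Di ein]]|no] := pselect (exists i, D i /\ e i = n); last first.
    by left; apply/seteqP; split=> // i ?; apply: no; exists i.
  right; exists i => //; apply/seteqP; split=> [j [Dj ejn]|_ ->]//.
  by apply: einj; [exact/mem_set|exact/mem_set|rewrite ejn].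
pose A n := \bigcup_(i in Dn n) (E `&` B5 i).
pose C n := \bigcup_(i in Dn n) B i.
have mA n : measurable (A n).
  rewrite /A; case: (Dn01 n) => [->|[i _ ->]].
    by rewrite bigcup_set0.
  by rewrite bigcup_set1; exact: measurableI.
have mC n : measurable (C n).
  rewrite /C; case: (Dn01 n) => [->|[i _ ->]].
    by rewrite bigcup_set0.
  by rewrite bigcup_set1.
have CU n : C n `<=` U by move=> x [i [/DE/fP[_ _ BU _] _]] /BU.
have AC n : \int[mu]_(x in A n) (g x)%:E <= s%:E * mu (C n).
  rewrite /A /C; case: (Dn01 n) => [->|[i /DE/fP[_ _ _ H] ->]].
    by rewrite !bigcup_set0 integral_set0 measure0 mule0.
  by rewrite !bigcup_set1.
have EA : E = \bigcup_n seqDU A n.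
  rewrite -seqDU_bigcup_eq; apply/seteqP; split => [y Ey|y [n _ [i _ []]]//].
  have [j Dj Bj] := coverD y Ey; have [_ yy _ _] := fP y Ey.
  by exists (e j) => //; exists j => //; split => //; exact: Bj.
have tC : trivIset setT C.
  move=> m n _ _ [x [[i [Di <-] Bi] [j [Dj <-] Bj]]].
  by congr (e _); apply: tD => //; exists x.
have mseq n : measurable (seqDU A n).
  rewrite /seqDU; apply: measurableD => //; exact: bigsetU_measurable.
have mgE (S : set X) : measurable_fun S (fun x => (g x)%:E).
  by apply/measurable_EFinP; apply: measurable_funTS.
rewrite [in leLHS]EA ge0_integral_bigcup//=; last first.
  by move=> x _; rewrite lee_fin.
apply: (@le_trans _ _ (\sum_(0 <= n <oo) (s%:E * mu (C n)))).
  apply: lee_nneseries => [n _ _|n _].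
    by apply: integral_ge0 => x _; rewrite lee_fin.
  apply: le_trans (AC n); apply: ge0_subset_integral => //.
    by move=> x _; rewrite lee_fin.
  exact: subset_seqDU.
rewrite nneseriesZl// lee_wpmul2l// ?lee_fin//.
rewrite [leLHS](_ : _ = mu (\bigcup_n C n)); last first.
  by rewrite measure_bigcup//; apply: eq_eseriesl => n; rewrite in_setT.
apply: le_measure_subset => //; first exact: bigcupT_measurable.
by move=> x [n _ /CU].
Qed.

End covering.

(** * Outer regularity *)

Section regularity.
Context (d : measure_display) (R : realType) (X : metricMeasurableType d R).
Variable mu : {measure set X -> \bar R}.
Hypothesis mu_Borel : complete_Borel_measure mu.

Lemma open_bigcup_closed (U : set X) : open U ->
  exists F : (set X)^nat, [/\ (forall n, closed (F n)),
    {homo F : n m / (n <= m)%N >-> n `<=` m} & U = \bigcup_n F n].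
Proof.
move=> oU.
(* The points at distance at least [1 / (n + 1)] from the complement of [U]. *)
pose F n := ~` \bigcup_(y in ~` U) ball y (n.+1%:R^-1)%R.
exists F; split.
- move=> n; apply: open_closedC; apply: bigcup_open => y _.
  exact: metric_ball_open.
- move=> n m nm; apply: subsetC => x [y Uy xy]; exists y => //.
  by apply: le_ball xy; rewrite lef_pV2 ?posrE// ler_nat.
- apply/seteqP; split => [x Ux|x [n _ Fx]]; last first.
    by apply: contrapT => Ux; apply: Fx; exists x => //; exact: ballxx.
  have : nbhs x U by rewrite nbhsE; exists U.
  move=> /nbhs_ballP[e /= e0 eU].
  have /ltr_add_invr[n] := e0; rewrite add0r => ne.
  exists n => // -[y Uy xy]; apply: Uy; apply: eU.
  by apply: ball_sym; apply: le_ball xy; exact: ltW.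
Qed.

Lemma Borel_measurable (A : set X) : Borel_set A -> measurable A.
Proof.
move=> bA; apply/mu_Borel; exists A, set0; split => //.
- exact: sigma_algebra0.
- by rewrite setDv.
Qed.

Section window.
Variable V : set X.
Hypotheses (oV : open V) (Voo : mu V < +oo).

Let mV : measurable V. Proof. exact: complete_Borel_open. Qed.

(** The inner approximation by closed sets is carried along because it makes the
    property stable under complements. *)
Let approx (A : set X) := forall e : R, (0 < e)%R -> exists C U : set X,
  [/\ closed C, open U, C `<=` A, A `<=` U & mu ((U `\` C) `&` V) <= e%:E].

Let complete_Borel_closed (C : set X) : closed C -> measurable C.
Proof.
move=> cC; rewrite -(setCK C); apply: measurableC.
by apply: complete_Borel_open => //; exact: closed_openC.
Qed.

Let small_tail (F : (set X)^nat) (e : R) : (0 < e)%R ->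
  (forall n, measurable (F n)) ->
  {homo F : n m / (n <= m)%N >-> m `<=` n} ->
  exists n, mu (F n `&` V) <= mu ((\bigcap_n F n) `&` V) + e%:E.
Proof.
move=> e0 mF ndF.
have mFV n : measurable (F n `&` V) by exact: measurableI.
have le_V A : measurable A -> mu (A `&` V) <= mu V.
  by move=> mA; apply: le_measure_subset => //; exact: measurableI.
have mcap : measurable (\bigcap_n F n) by exact: bigcap_measurable.
have : mu (F n `&` V) @[n --> \oo] --> mu ((\bigcap_n F n) `&` V).
  rewrite -bigcapIl; last by exists 0%N.
  apply: nonincreasing_cvg_mu => //.
  - by rewrite (le_lt_trans _ Voo)// le_V.
  - by apply: bigcap_measurable => //; exists 0%N.
  - by move=> n m nm; apply/subsetPset; apply: setSI; exact: ndF.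
have fin_cap : mu ((\bigcap_n F n) `&` V) \is a fin_num.
  by rewrite ge0_fin_numE// (le_lt_trans _ Voo)// le_V.
have lt_lim : mu ((\bigcap_n F n) `&` V) < mu ((\bigcap_n F n) `&` V) + e%:E.
  by rewrite lteDl// lte_fin.
move=> /(_ _ (open_ereal_lt' lt_lim))[n _ /(_ n (leqnn n)) Fn].
by exists n; exact: ltW.
Qed.

Let approx_open (A : set X) : open A -> approx A.
Proof.
move=> oA e e0; have [F [cF ndF AF]] := open_bigcup_closed oA.
have [n|n m nm|n Hn] := small_tail (F := fun n => A `\` F n) e0.
- apply: measurableD; first exact: complete_Borel_open.
  exact: complete_Borel_closed.
- by apply: setDS; exact: ndF.
exists (F n), A; split => //; first by rewrite AF; exact: bigcup_sup.
apply: (le_trans Hn).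
rewrite (_ : \bigcap_n _ = set0) ?set0I ?measure0 ?add0e//.
apply/seteqP; split => // x Fx.
have [Ax _] := Fx 0%N I; move: (Ax); rewrite AF => -[k _ Fk].
by have [_] := Fx k I.
Qed.

Let approx_setC (A : set X) : approx A -> approx (~` A).
Proof.
move=> apA e e0; have [C [U [cC oU CA AU le_e]]] := apA e e0.
exists (~` U), (~` C); split.
- exact: open_closedC.
- exact: closed_openC.
- exact: subsetC.
- exact: subsetC.
- by rewrite (_ : ~` C `\` ~` U = U `\` C)// !setDE setCK setIC.
Qed.

Let approx_bigcup (A : (set X)^nat) :
  (forall n, approx (A n)) -> approx (\bigcup_n A n).
Proof.
move=> apA e e0; have e2 : (0 < e / 2)%R by rewrite divr_gt0.
have en n : (0 < e / 2 / (2 ^ n.+1)%:R)%R by rewrite divr_gt0// ltr0n expn_gt0.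
pose good n (p : set X * set X) := [/\ closed p.1, open p.2, p.1 `<=` A n,
  A n `<=` p.2 & mu ((p.2 `\` p.1) `&` V) <= (e / 2 / (2 ^ n.+1)%:R)%:E].
have [f fP] : {f & forall n, good n (f n)}.
  by apply: choice => n; have [C [U CU]] := apA n _ (en n); exists (C, U).
pose C n := (f n).1; pose U n := (f n).2.
have cC n : closed (C n) by have [] := fP n.
have oU n : open (U n) by have [] := fP n.
have mC n : measurable (C n) by exact: complete_Borel_closed.
have mU n : measurable (U n) by exact: complete_Borel_open.
pose W := \bigcup_n U n; pose K n := \big[setU/set0]_(i < n) C i.
have cK n : closed (K n) by apply: closed_bigsetU => i _.
have mK n : measurable (K n) by exact: complete_Borel_closed.
have mW : measurable W by exact: bigcupT_measurable.
have [n|n m nm|n Hn] := small_tail (F := fun n => W `\` K n) e2.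
- exact: measurableD.
- by apply: setDS; exact: subset_bigsetU.
exists (K n), W; split => //.
- exact: bigcup_open.
- rewrite /K -bigcup_mkord => x [i _ Cx]; exists i => //.
  by have [_ _ + _ _] := fP i; exact.
- by apply: subset_bigcup => i _; have [] := fP i.
apply: (le_trans Hn); rewrite [in leRHS](splitr e) EFinD leeD2r//.
apply: le_trans (epsilon_trick0 xpredT (ltW e2)).
apply: (@le_trans _ _ (\sum_(i <oo) mu ((U i `\` C i) `&` V))); last first.
  by apply: lee_nneseries => // i _; have [] := fP i.
apply: measure_sigma_subadditive.
- by move=> i; apply: measurableI => //; exact: measurableD.
- apply: measurableI => //; apply: bigcap_measurable => // i _.
  exact: measurableD.
- move=> x [Wx Vx]; have [[i _ Ux] _] := Wx 0%N I.
  exists i => //; split=> //; split=> // Cx.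
  have [_] := Wx i.+1 I; apply; rewrite /K -bigcup_mkord.
  by exists i => //=.
Qed.

Let approx_Borel (A : set X) : Borel_set A -> approx A.
Proof.
apply: smallest_sub; last by move=> U oU; exact: approx_open.
split.
- by apply: approx_open; exact: open0.
- by move=> B /approx_setC; rewrite setTD.
- exact: approx_bigcup.
Qed.

(** A measurable set lies between a Borel set [B] and the union of [B] and a
    Borel null set, so it inherits the regularity of Borel sets. *)
Lemma outer_regular (A : set X) (e : R) : (0 < e)%R ->
  measurable A -> A `<=` V ->
  exists U, [/\ open U, A `<=` U, U `<=` V & mu U <= mu A + e%:E].
Proof.
move=> e0 mA AV.
have [B [Z [bB bZ Z0 BA ABZ]]] : exists B Z : set X, [/\ Borel_set B,
    Borel_set Z, mu Z = 0, B `<=` A & A `\` B `<=` Z] by apply/mu_Borel.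
have bBZ : Borel_set (B `|` Z).
  rewrite -bigcup2E; apply: sigma_algebra_bigcup => -[|[|i]] //=.
  exact: sigma_algebra0.
have [C [U [cC oU CBZ BZU le_e]]] := approx_Borel bBZ e0.
have mU := complete_Borel_open mu_Borel oU.
have mC := complete_Borel_closed cC.
have mB := Borel_measurable bB.
have mZ := Borel_measurable bZ.
exists (U `&` V); split => //.
- exact: openI.
- move=> x Ax; split; last exact: AV.
  by apply: BZU; have [Bx|nBx] := pselect (B x); [left|right; apply: ABZ].
have UVE : U `&` V `<=` ((U `\` C) `&` V) `|` (B `|` Z).
  move=> x [Ux Vx]; have [Cx|nCx] := pselect (C x); last by left.
  by right; exact: CBZ.
have mUCV : measurable ((U `\` C) `&` V).
  by apply: measurableI => //; exact: measurableD.
apply: (@le_trans _ _ (mu (((U `\` C) `&` V) `|` (B `|` Z)))).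
  apply: le_measure_subset => //; first exact: measurableI.
  by apply: measurableU => //; exact: measurableU.
apply: (le_trans (measureU2 mu mUCV (measurableU _ _ mB mZ))).
rewrite addeC leeD//; apply: (le_trans (measureU2 mu mB mZ)).
have Zle : mu Z <= 0 by rewrite Z0.
by rewrite -[leRHS]adde0; apply: leeD => //; exact: le_measure_subset.
Qed.

End window.
End regularity.

(** * The maximal function of a bounded function *)

Section maximal.
Context (d : measure_display) (R : realType) (X : metricMeasurableType d R).
Variable mu : {measure set X -> \bar R}.
Hypothesis mu_Borel : complete_Borel_measure mu.
Hypothesis mu_ball : balls_pos_finite mu.

Definition bounded_mfun (N : R) (g : X -> R) :=
  measurable_fun setT g /\ forall x, (0 <= g x <= N)%R.

(** The maximal function of a nonnegative bounded function is finite
    everywhere, which is what makes [fine] harmless here ([hlE]). *)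
Definition hl (g : X -> R) (x : X) : R := fine (noncentered_maximal mu g x).

Lemma average_le (N : R) (g : X -> R) z r (t : R) : bounded_mfun N g ->
  (0 < r)%R ->
  (average mu g (ball z r) <= t%:E) =
  (\int[mu]_(x in ball z r) (g x)%:E <= t%:E * mu (ball z r)).
Proof.
move=> [_ gN] r0; rewrite /average.
have /andP[m0 moo] := mu_ball z r0.
have mfin : mu (ball z r) \is a fin_num by rewrite ge0_fin_numE// ltW.
have m_gt0 : (0 < fine (mu (ball z r)))%R by rewrite fine_gt0// m0.
have -> : \int[mu]_(y in ball z r) `|g y|%:E =
    \int[mu]_(y in ball z r) (g y)%:E.
  by apply: eq_integral => y _; have /andP[g0 _] := gN y; rewrite ger0_norm.
rewrite -(fineK mfin) inver gt_eqF// lee_pdivrMl//.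
by rewrite muleC.
Qed.

Lemma integral_le_cst (g : X -> R) (N : R) z r : bounded_mfun N g ->
  \int[mu]_(x in ball z r) (g x)%:E <= N%:E * mu (ball z r).
Proof.
move=> [mg gN]; rewrite -integral_cst; last exact: complete_Borel_ball.
apply: ge0_le_integral => //.
- exact: complete_Borel_ball.
- by move=> x _; rewrite lee_fin; have /andP[] := gN x.
- by apply/measurable_EFinP; apply: measurable_funTS.
- by move=> x _; rewrite lee_fin; have /andP[] := gN x.
Qed.

Lemma hlE (N : R) g x : bounded_mfun N g ->
  noncentered_maximal mu g x = (hl g x)%:E /\ (0 <= hl g x <= N)%R.
Proof.
move=> bg; rewrite /hl.
have M0 : 0 <= noncentered_maximal mu g x.
  apply: (@le_trans _ _ (average mu g (ball x 1))).
    rewrite /average mule_ge0//; last by apply: integral_ge0.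
    by rewrite inve_ge0.
  by apply: ereal_sup_ubound; exists x, 1%R; split => //; exact: ballxx.
have MN : noncentered_maximal mu g x <= N%:E.
  apply/ereal_supP => _ [z [r [r0 _ ->]]].
  by rewrite (average_le _ _ bg)//; exact: integral_le_cst.
have Mfin : noncentered_maximal mu g x \is a fin_num.
  by rewrite ge0_fin_numE// (le_lt_trans MN)// ltry.
by split; rewrite ?fineK// -!lee_fin fineK// M0.
Qed.

Lemma integral_le_hl (N : R) g z r x : bounded_mfun N g -> (0 < r)%R ->
  ball z r x ->
  \int[mu]_(y in ball z r) (g y)%:E <= (hl g x)%:E * mu (ball z r).
Proof.
move=> bg r0 zx; rewrite -(average_le _ _ bg)// -(hlE x bg).1.
by apply: ereal_sup_ubound; exists z, r.
Qed.

Lemma hl_le (N : R) g x (t : R) : bounded_mfun N g ->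
  (forall z r, (0 < r)%R -> ball z r x ->
    \int[mu]_(y in ball z r) (g y)%:E <= t%:E * mu (ball z r)) ->
  (hl g x <= t)%R.
Proof.
move=> bg H; rewrite -lee_fin -(hlE x bg).1.
apply/ereal_supP => _ [z [r [r0 zx ->]]].
by rewrite (average_le _ _ bg)//; exact: H.
Qed.

Lemma hl_gt (N : R) g x (t : R) : bounded_mfun N g -> (t < hl g x)%R ->
  exists z r, [/\ (0 < r)%R, ball z r x &
    t%:E * mu (ball z r) < \int[mu]_(y in ball z r) (g y)%:E].
Proof.
move=> bg; rewrite -lte_fin -(hlE x bg).1.
move=> /ereal_sup_gt[_ [z [r [r0 zx ->]]]].
by rewrite ltNge (average_le _ _ bg)// -ltNge; exists z, r.
Qed.

Lemma lt_hl (N : R) g z r x (t : R) : bounded_mfun N g -> (0 < r)%R ->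
  ball z r x -> t%:E * mu (ball z r) < \int[mu]_(y in ball z r) (g y)%:E ->
  (t < hl g x)%R.
Proof.
move=> bg r0 zx; rewrite !ltNge; apply: contra => ht.
apply: le_trans (integral_le_hl bg r0 zx) _.
by apply: lee_wpmul2r.
Qed.

Lemma hl_superlevel_open (N : R) g t : bounded_mfun N g ->
  open [set x | (t < hl g x)%R].
Proof.
move=> bg; rewrite openE => x /= /(hl_gt bg)[z [r [r0 zx tr]]].
rewrite /interior /= nbhsE /=; exists (ball z r).
  by split; first exact: metric_ball_open.
by move=> y zy /=; exact: lt_hl bg r0 zy tr.
Qed.

Lemma bounded_hl (N : R) g : bounded_mfun N g -> bounded_mfun N (hl g).
Proof.
move=> bg; split; last by move=> x; have [] := hlE x bg.
apply: (measurability _ (measurable_realfun.RGenOInfty.measurableE R)).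
move=> _ [_ [t ->] <-]; rewrite setTI.
rewrite (_ : _ @^-1` _ = [set x | (t < hl g x)%R]); last first.
  by apply/seteqP; split => x /=; rewrite in_itv /= andbT.
by apply: (complete_Borel_open mu_Borel); exact: hl_superlevel_open bg.
Qed.

(** Monotonicity up to a constant replaces sublinearity: it says that the
    maximal operator does not increase the uniform distance. *)
Lemma hl_le_addr (N N' : R) g g' (s : R) :
  bounded_mfun N g -> bounded_mfun N' g' -> (0 <= s)%R ->
  (forall x, g x <= g' x + s)%R -> forall x, (hl g x <= hl g' x + s)%R.
Proof.
move=> bg bg' s0 gg' x; apply: (hl_le bg) => z r r0 zx.
have mB : measurable (ball z r) by exact: complete_Borel_ball.
have mE h M : bounded_mfun M h -> measurable_fun (ball z r) (fun x => (h x)%:E).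
  by case=> mh _; apply/measurable_EFinP; apply: measurable_funTS.
have g0 h M : bounded_mfun M h -> forall y, 0 <= (h y)%:E.
  by case=> _ hM y; rewrite lee_fin; have /andP[] := hM y.
apply: (@le_trans _ _ (\int[mu]_(y in ball z r) ((g' y)%:E + s%:E))).
  apply: ge0_le_integral => //.
  - by move=> y _; exact: g0 bg _.
  - exact: mE bg.
  - by apply: emeasurable_funD => //; exact: mE bg'.
  - by move=> y _; rewrite -EFinD lee_fin.
rewrite ge0_integralD//.
- rewrite integral_cst// EFinD ge0_muleDl ?lee_fin//; last first.
    by have [_ /andP[]] := hlE x bg'.
  by rewrite leeD2r//; exact: integral_le_hl bg' r0 zx.
- by move=> y _; exact: g0 bg' _.
- exact: mE bg'.
Qed.

Lemma le_hl (N N' : R) g g' : bounded_mfun N g -> bounded_mfun N' g' ->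
  (forall x, g x <= g' x)%R -> forall x, (hl g x <= hl g' x)%R.
Proof.
move=> bg bg' gg' x; rewrite -[leRHS]addr0.
by apply: (hl_le_addr bg bg') => // y; rewrite addr0.
Qed.

End maximal.

(** * Consequences of the doubling property *)

Section doubling.
Context (d : measure_display) (R : realType) (X : metricMeasurableType d R).
Variable mu : {measure set X -> \bar R}.
Hypothesis mu_Borel : complete_Borel_measure mu.
Hypothesis mu_ball : balls_pos_finite mu.
Variable c : R.
Hypothesis c_ge1 : (1 <= c)%R.
Hypothesis mu_doubling : doubling mu c.

Let mB z r : measurable (ball z r : set X).
Proof. exact: complete_Borel_ball. Qed.

Let c0 : (0 <= c)%R. Proof. exact: le_trans c_ge1. Qed.

Lemma mu_ball8 z r : (0 < r)%R ->
  mu (ball z (8 * r)%R) <= (c ^+ 3)%:E * mu (ball z r).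
Proof.
move=> r0.
have r2 : (0 < 2 * r)%R by rewrite mulr_gt0.
have r4 : (0 < 2 * (2 * r))%R by rewrite mulr_gt0.
rewrite (_ : 8 * r = 2 * (2 * (2 * r)))%R; last by lra.
rewrite !exprS expr0 mulr1 !EFinM -!muleA.
apply: le_trans (mu_doubling z r4) _; apply: lee_wpmul2l; rewrite ?lee_fin//.
apply: le_trans (mu_doubling z r2) _; apply: lee_wpmul2l; rewrite ?lee_fin//.
exact: mu_doubling.
Qed.

Lemma mu_ball5 z r : (0 < r)%R ->
  mu (ball z (5 * r)%R) <= (c ^+ 3)%:E * mu (ball z r).
Proof.
move=> r0; apply: le_trans (mu_ball8 z r0); apply: le_measure_subset => //.
by apply: le_ball; lra.
Qed.

(** Each point of the superlevel set is in a ball where the average of [g]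
    exceeds [t]; one of nearly maximal radius is chosen, so that the ball with
    the same centre and five times the radius has average at most [t].  The
    lower bound on [t] forces these radii to be at most [r / 2]: otherwise the
    ball of eight times the radius would contain [x], and its average would
    exceed [hl mu g x].  This keeps the selected balls inside
    [ball x0 (2 * r)]. *)
Lemma integral_level_set (N : R) (g : X -> R) x0 r x (t : R) :
  bounded_mfun N g -> (0 < r)%R -> ball x0 r x -> (0 < t)%R ->
  (c ^+ 3 * hl mu g x <= t)%R ->
  \int[mu]_(y in ball x0 r `&` [set y | (t < hl mu g y)%R]) (g y)%:E
    <= (c ^+ 3 * t)%:E * mu (ball x0 (2 * r)%R `&` [set y | (t < hl mu g y)%R]).
Proof.
move=> bg r0 x0x t0 ct.
have mlev : measurable [set y | (t < hl mu g y)%R].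
  by apply: (complete_Borel_open mu_Borel); exact: hl_superlevel_open bg.
have r20 : (0 < 2 * r)%R by rewrite mulr_gt0.
have [mg gN] := bg.
have g0 y : (0 <= g y)%R by have /andP[] := gN y.
have mgE (S : set X) : measurable_fun S (fun x => (g x)%:E).
  by apply/measurable_EFinP; apply: measurable_funTS.
have g0E y : 0 <= (g y)%:E by rewrite lee_fin.
apply: (integral_le_of_covering (r0 := (r / 2)%R) mu_Borel mu_ball) => //.
- by rewrite mulr_ge0 ?exprn_ge0// ltW.
- exact: measurableI.
- exact: measurableI.
- apply: (@le_lt_trans _ _ (mu (ball x0 (2 * r)%R))).
    by apply: le_measure_subset => //; exact: measurableI.
  by have /andP[] := mu_ball x0 r20.
move=> y [x0y ty].
pose S := [set rho : R | (0 < rho)%R /\ exists2 z, ball z rho y &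
  t%:E * mu (ball z rho) < \int[mu]_(u in ball z rho) (g u)%:E].
have S_le rho : S rho -> (rho <= r / 2)%R.
  move=> [rho0 [z zy zt]]; rewrite leNgt; apply/negP => r_lt.
  have rho8 : (0 < 8 * rho)%R by rewrite mulr_gt0.
  have zx : ball z (8 * rho)%R x.
    apply: (@le_ball _ _ _ (rho + (r + r))%R); first by lra.
    by apply: ball_triangle zy _; apply: ball_triangle x0x; exact: ball_sym.
  move: zt; rewrite ltNge => /negP; apply.
  apply: (@le_trans _ _ (\int[mu]_(u in ball z (8 * rho)%R) (g u)%:E)).
    by apply: ge0_subset_integral => //; apply: le_ball; lra.
  apply: le_trans (integral_le_hl mu_Borel mu_ball bg rho8 zx) _.
  apply: (@le_trans _ _ ((hl mu g x)%:E * ((c ^+ 3)%:E * mu (ball z rho)))).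
    apply: lee_wpmul2l; last exact: mu_ball8.
    by rewrite lee_fin; have [_ /andP[]] := hlE mu_Borel mu_ball x bg.
  by rewrite muleA -EFinM; apply: lee_wpmul2r => //; rewrite lee_fin mulrC.
have [z1 [r1 [r10 z1y tr1]]] := hl_gt mu_Borel mu_ball bg ty.
have Sr1 : S r1 by split => //; exists z1.
have supS : has_sup S by split; [exists r1|exists (r / 2)%R => rho /S_le].
have S_sup rho : S rho -> (rho <= sup S)%R.
  by move=> ?; apply: ub_le_sup (supS.2) _ _.
have sup_gt0 : (0 < sup S)%R by exact: lt_le_trans r10 (S_sup _ Sr1).
have [rho Srho sup_rho] := sup_adherent (divr_gt0 sup_gt0 (ltr0Sn R 1)) supS.
have rhor := S_le _ Srho; have [rho0 [z zy zt]] := Srho.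
have rho5 : (0 < 5 * rho)%R by rewrite mulr_gt0.
have z5y : ball z (5 * rho)%R y by apply: le_ball zy; lra.
exists z, rho; split => //.
- by rewrite rho0.
- move=> p zp; split; last exact: (lt_hl mu_Borel mu_ball bg rho0 zp zt).
  apply: (@le_ball _ _ _ (r + (rho + rho))%R); first by lra.
  by apply: ball_triangle x0y _; apply: ball_triangle zp; exact: ball_sym.
- apply: (@le_trans _ _ (\int[mu]_(u in ball z (5 * rho)%R) (g u)%:E)).
    apply: ge0_subset_integral => //.
    by apply: measurableI => //; exact: measurableI.
  apply: (@le_trans _ _ (t%:E * mu (ball z (5 * rho)%R))).
    rewrite leNgt; apply/negP => t5.
    have /S_sup : S (5 * rho)%R by split => //; exists z.
    by move: sup_rho; lra.
  rewrite [(c ^+ 3 * t)%R]mulrC EFinM -muleA; apply: lee_wpmul2l.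
    by rewrite lee_fin ltW.
  exact: mu_ball5.
Qed.

(** It suffices to show that, for every positive rational [q] and within every
    ball around [x0], the set [F] where [g > q] and
    [hl mu g <= q / (4 * c ^ 3)] is null.  Take an open set [U] that contains
    [F] and has at most twice its measure, and cover [F] by balls inside [U]
    with centres in [F].  The bound on [hl mu g] at a centre says that [F]
    fills at most the proportion [1 / (4 * c ^ 3)] of the ball enlarged by 5,
    whose measure is at most [c ^ 3] times that of the original ball.  Hence [F]
    has at most a quarter of the measure of [U], that is, half of its own. *)
Lemma ae_le_hl (x0 : X) (N : R) (g : X -> R) : bounded_mfun N g ->
  {ae mu, forall x, (g x <= 4 * c ^+ 3 * hl mu g x)%R}.
Proof.
move=> bg; set K := (4 * c ^+ 3)%R.
have c3 : (1 <= c ^+ 3)%R by rewrite exprn_ege1.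
have K0 : (0 < K)%R by rewrite /K; lra.
have [mg gN] := bg; have [mh hN] := bounded_hl mu_Borel mu_ball bg.
have h0 y : (0 <= hl mu g y)%R by have /andP[] := hN y.
have g0 y : (0 <= g y)%R by have /andP[] := gN y.
pose q k l : R := (k.+1%:R / l.+1%:R)%R.
pose F k l m := ball x0 m.+1%:R `&` ([set y | (q k l < g y)%R] `&`
  [set y | (hl mu g y <= q k l / K)%R]).
suff negF k l m : mu.-negligible (F k l m).
  apply: (@negligibleS _ _ _ _ (\bigcup_k \bigcup_l \bigcup_m F k l m));
    last first.
    do 3 apply: negligible_bigcup => ?; exact: negF.
  move=> y /= /negP; rewrite -ltNge => Kg.
  have [l] := ltr_add_invr Kg => Kl.
  have l0 : (0 < l.+1%:R :> R)%R by [].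
  (* The rational [q k l] is the least multiple of [1 / (l + 1)] beyond
     [K * hl mu g y]. *)
  pose k := Num.truncn (K * hl mu g y * l.+1%:R)%R.
  have kge : (K * hl mu g y < q k l)%R by rewrite ltr_pdivlMr// truncnS_gt.
  have kle : (q k l <= K * hl mu g y + l.+1%:R^-1)%R.
    rewrite /q ler_pdivrMr// mulrDl mulVf ?gt_eqF// -natr1 lerD2r.
    by rewrite truncn_le// !mulr_ge0// ltW.
  exists k => //; exists l => //; exists (Num.truncn (mdist x0 y)) => //.
  split; first by rewrite ballEmdist /= truncnS_gt.
  split; first exact: le_lt_trans kle Kl.
  by rewrite /= ler_pdivlMr// mulrC ltW.
have q0 : (0 < q k l)%R by rewrite divr_gt0.
set A := F k l m.
have mA : measurable A.
  apply: measurableI => //; apply: measurableI.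
    rewrite (_ : [set _ | _] = g @^-1` `]q k l, +oo[).
      by rewrite -[_ @^-1` _]setTI; exact: mg.
    by apply/seteqP; split => u /=; rewrite in_itv /= andbT.
  rewrite (_ : [set _ | _] = hl mu g @^-1` `]-oo, (q k l / K)%R]).
    by rewrite -[_ @^-1` _]setTI; exact: mh.
  by apply/seteqP; split => u /=; rewrite in_itv.
have m0 : (0 < m.+1%:R :> R)%R by [].
have Voo : mu (ball x0 m.+1%:R) < +oo by have /andP[] := mu_ball x0 m0.
have AV : A `<=` ball x0 m.+1%:R by move=> u [].
have muA_fin : mu A \is a fin_num.
  by rewrite ge0_fin_numE// (le_lt_trans _ Voo)// le_measure_subset.
apply/negligibleP => //; apply/eqP; rewrite eq_le measure_ge0 andbT leNgt.
apply/negP => A_gt0.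
have a0 : (0 < fine (mu A))%R by rewrite fine_gt0// A_gt0 -ge0_fin_numE.
have [U [oU AU UV]] :=
  outer_regular mu_Borel (metric_ball_open _ _) Voo a0 mA AV.
rewrite fineK// => muU.
have mU := complete_Borel_open mu_Borel oU.
have : \int[mu]_(y in A) (1%R : R)%:E <= (4^-1)%:E * mu U.
  apply: (integral_le_of_covering (g := cst 1%R) (r0 := 1) mu_Borel mu_ball)
    => //.
    by rewrite (le_lt_trans _ Voo)// le_measure_subset.
  move=> y Ay; have : nbhs y U.
    by rewrite nbhsE; exists U => //; split => //; exact: AU.
  move=> /nbhs_ballP[e /= e0 eU].
  pose r := Num.min e 1%R; have r0 : (0 < r)%R by rewrite lt_min e0 ltr01.
  exists y, r; split => //.
  - by rewrite r0 /r ge_min lexx orbT.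
  - exact: ballxx.
  - by apply: subset_trans eU; apply: le_ball; rewrite /r ge_min lexx.
  have r5 : (0 < 5 * r)%R by rewrite mulr_gt0.
  have mA5 : measurable (A `&` ball y (5 * r)%R) by exact: measurableI.
  have : \int[mu]_(u in A `&` ball y (5 * r)%R) (q k l)%:E <=
      (q k l / K)%:E * ((c ^+ 3)%:E * mu (ball y r)).
    apply: (@le_trans _ _ (\int[mu]_(u in ball y (5 * r)%R) (g u)%:E)).
      apply: (@le_trans _ _ (\int[mu]_(u in A `&` ball y (5 * r)%R) (g u)%:E)).
        apply: ge0_le_integral => //.
        - by move=> u _; rewrite lee_fin ltW.
        - by apply/measurable_EFinP; apply: measurable_funTS.
        - by move=> u [[_ [/= qu _]] _]; rewrite lee_fin ltW.
      apply: ge0_subset_integral => //.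
      - by apply/measurable_EFinP; apply: measurable_funTS.
      - by move=> u _; rewrite lee_fin.
    have yy : ball y (5 * r)%R y by exact: ballxx.
    apply: le_trans (integral_le_hl mu_Borel mu_ball bg r5 yy) _.
    apply: lee_pmul => //; [by rewrite lee_fin| |exact: mu_ball5].
    by rewrite lee_fin; case: Ay => _ [].
  rewrite !integral_cst// mul1e => Hq.
  rewrite -(@lee_pmul2l _ (q k l)%:E) ?lte_fin//; apply: le_trans Hq _.
  rewrite !muleA -!EFinM; apply: lee_wpmul2r => //; rewrite lee_fin -mulrA.
  apply: ler_wpM2l; first exact: ltW.
  by rewrite /K invfM -mulrA mulVf ?mulr1// gt_eqF//; lra.
rewrite integral_cst// mul1e => muAU.
have : mu A <= (4^-1)%:E * (mu A + mu A).
  by apply: le_trans muAU _; apply: lee_wpmul2l => //; rewrite lee_fin invr_ge0.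
rewrite -(fineK muA_fin) -EFinD -EFinM lee_fin; lra.
Qed.

End doubling.

(** * The reverse Hoelder inequality for A_1 weights *)

Section dyadic.
Variable R : realType.
Implicit Types a u delta : R.

(** A discrete layer-cake formula for [u ^ delta] along the levels [a * 2 ^ j].
    The factor [2 ^ delta - 1], which tends to zero with [delta], is what makes
    the reverse Hoelder inequality possible. *)
Lemma powR_dyadic_le a u delta J : (0 < a)%R -> (0 <= u)%R -> (0 <= delta)%R ->
  (u <= a * 2 ^+ J)%R ->
  (u `^ delta <= a `^ delta +
    \sum_(j < J) (2 `^ delta - 1) * (a * 2 ^+ j) `^ delta
      * ((a * 2 ^+ j < u)%R : nat)%:R)%R.
Proof.
move=> a0 u0 delta0; elim: J u u0 => [|J IH] u u0.
  rewrite expr0 mulr1 big_ord0 addr0 => ua.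
  by apply: ge0_ler_powR => //; rewrite nnegrE// ltW.
have t0 j : (0 < a * 2 ^+ j)%R by rewrite mulr_gt0// exprn_gt0.
have kap : (0 <= 2 `^ delta - 1 :> R)%R.
  by rewrite subr_ge0 -[leLHS](powRr0 2) ler_powR// ler1n.
rewrite big_ord_recr /=; have [uJ _|uJ uJ1] := leP u (a * 2 ^+ J)%R.
  by rewrite mulr0 addr0; exact: IH.
rewrite mulr1 addrA.
have /le_trans : (u `^ delta <= (a * 2 ^+ J.+1) `^ delta)%R.
  by apply: ge0_ler_powR => //; rewrite nnegrE// ltW.
apply; rewrite exprS mulrCA (powRM _ _ (ltW (t0 J)))// mulrBl mul1r.
set T := ((a * 2 ^+ J) `^ delta)%R; set S := (a `^ delta + _)%R.
suff TS : (T <= S)%R by lra.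
apply: le_trans (IH _ (ltW (t0 J)) (lexx _)) _; rewrite lerD2l.
apply: ler_sum => j _; apply: ler_wpM2l; first by rewrite mulr_ge0// powR_ge0.
have jJ : (a * 2 ^+ j < a * 2 ^+ J)%R.
  by rewrite ltr_pM2l// ltr_eXn2l// ltr1n.
by rewrite jJ (lt_trans jJ uJ).
Qed.

Lemma sum_dyadic_le a u J : (0 < a)%R -> (0 <= u)%R ->
  (\sum_(j < J) (a * 2 ^+ j) * ((a * 2 ^+ j < u)%R : nat)%:R <= 2 * u)%R.
Proof.
move=> a0 u0.
have S_le I : (\sum_(j < I) (a * 2 ^+ j) * ((a * 2 ^+ j < u)%R : nat)%:R
    <= a * 2 ^+ I)%R.
  elim: I => [|I IH]; first by rewrite big_ord0 expr0 mulr1 ltW.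
  rewrite big_ord_recr /= exprS mulrCA [leRHS]mulrDl mul1r; apply: lerD => //.
  rewrite ler_piMr//; last by case: (_ < _)%R.
  by rewrite mulr_ge0 ?exprn_ge0// ltW.
elim: J => [|J IH]; first by rewrite big_ord0 mulr_ge0.
rewrite big_ord_recr /=; have [uJ|uJ] := leP u (a * 2 ^+ J)%R.
  by rewrite mulr0 addr0.
by have := S_le J; rewrite mulr1; lra.
Qed.

End dyadic.

Section reverse_Holder.
Context (d : measure_display) (R : realType) (X : metricMeasurableType d R).
Variable mu : {measure set X -> \bar R}.
Hypothesis mu_Borel : complete_Borel_measure mu.
Hypothesis mu_ball : balls_pos_finite mu.
Variable c : R.
Hypothesis c_ge1 : (1 <= c)%R.
Hypothesis mu_doubling : doubling mu c.

Variables (N eta K delta : R) (G : X -> R).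
Hypothesis bG : bounded_mfun N G.
Hypothesis eta0 : (0 < eta)%R.
Hypothesis G_ge : forall x, (eta <= G x)%R.
Hypothesis A1 : forall x, (hl mu G x <= K * G x)%R.
Hypothesis delta01 : (0 < delta <= 1)%R.
Hypothesis delta_small : ((2 `^ delta - 1) * (4 * c ^+ 4 * K) <= 1)%R.

Let u := hl mu G.

(** The reverse Hoelder inequality with constant [Phi].  It holds trivially for
    some [Phi] that depends on the bounds of [G] ([valid_init]); the level-set
    estimate turns [Phi] into [c ^ 3 + Phi / 2] ([valid_step]), and iterating
    this brings the constant below [2 * c ^ 3 + 1]. *)
Let valid (Phi : R) := forall x0 r x, (0 < r)%R -> ball x0 r x ->
  \int[mu]_(y in ball x0 r) (G y * u y `^ delta)%:E <=
    (Phi * (u x `^ delta * u x))%:E * mu (ball x0 r).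

Let mB z r : measurable (ball z r : set X).
Proof. exact: complete_Borel_ball. Qed.

Let delta0 : (0 <= delta)%R. Proof. by case/andP: delta01 => /ltW. Qed.

Let bu : bounded_mfun N u. Proof. exact: bounded_hl. Qed.

Let u_ge x : (eta <= u x)%R.
Proof.
have [mG GN] := bG.
have /andP[m0 moo] := mu_ball x (@ltr01 R).
have := integral_le_hl mu_Borel mu_ball bG (@ltr01 R) (ballxx x (@ltr01 R)).
have : \int[mu]_(y in ball x 1%R) (eta%:E) <=
    \int[mu]_(y in ball x 1%R) (G y)%:E.
  apply: ge0_le_integral => //.
  - by move=> y _; rewrite lee_fin ltW.
  - by apply/measurable_EFinP; apply: measurable_funTS.
  - by move=> y _; rewrite lee_fin.
move=> /le_trans/[apply]; rewrite integral_cst// lee_pmul2r ?lee_fin//.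
by rewrite ge0_fin_numE// ltW.
Qed.

Let u0 x : (0 < u x)%R. Proof. exact: lt_le_trans (u_ge x). Qed.

Let G0 x : (0 <= G x)%R. Proof. by rewrite (le_trans _ (G_ge x))// ltW. Qed.

Let mpow (D : set X) (q : R) : measurable_fun D (fun y => u y `^ q)%R.
Proof.
apply: (measurableT_comp (measurable_powR _)) => //.
by apply: measurable_funTS; case: bu.
Qed.

Let mG (D : set X) : measurable_fun D G.
Proof. by apply: measurable_funTS; case: bG. Qed.

Let valid_init : valid ((N / eta) `^ delta).
Proof.
move=> x0 r x r0 x0x; have [_ uN] := bu.
have N0 : (0 <= N)%R by have /andP[h1 h2] := uN x; exact: le_trans h2.
apply: (@le_trans _ _ (\int[mu]_(y in ball x0 r) ((N `^ delta)%:E * (G y)%:E))).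
  apply: ge0_le_integral => //.
  - by move=> y _; rewrite lee_fin mulr_ge0// powR_ge0.
  - by apply/measurable_EFinP; apply: measurable_funM.
  - by apply/measurable_EFinP; apply: measurable_funM.
  - move=> y _; rewrite -EFinM lee_fin mulrC ler_wpM2r//.
    apply: ge0_ler_powR; rewrite ?nnegrE//; first exact: ltW.
    by have /andP[] := uN y.
rewrite ge0_integralZl//; last 3 first.
- by apply/measurable_EFinP.
- by move=> y _; rewrite lee_fin.
- by rewrite lee_fin powR_ge0.
have ux : (u x `^ delta != 0)%R by rewrite gt_eqF// powR_gt0.
apply: (@le_trans _ _ ((N `^ delta)%:E * ((u x)%:E * mu (ball x0 r)))).
  apply: lee_wpmul2l; first by rewrite lee_fin powR_ge0.
  exact: integral_le_hl bG r0 x0x.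
rewrite muleA -EFinM; apply: lee_wpmul2r => //; rewrite lee_fin mulrA.
apply: ler_wpM2r; first exact: ltW.
rewrite -powRM; [|by rewrite divr_ge0// ltW|exact: ltW].
apply: ge0_ler_powR; rewrite ?nnegrE//.
  by rewrite mulr_ge0 ?(ltW (u0 x))// divr_ge0// ltW.
by rewrite mulrAC ler_pdivlMr// ler_wpM2l.
Qed.

Let integral_indicM (D L : set X) : measurable D -> measurable L ->
  \int[mu]_(y in D) (G y * ((y \in L) : nat)%:R)%:E =
  \int[mu]_(y in D `&` L) (G y)%:E.
Proof.
move=> mD mL; rewrite integral_mkcondr; apply: eq_integral => y _.
by rewrite patchE; case: ifPn => yL; rewrite ?mulr1 ?mulr0.
Qed.

(** The part of the layer-cake sum below the level [a = c ^ 3 * u x] gives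
    [c ^ 3].  On the levels [t j >= a], [integral_level_set] replaces the
    integral of [G] by [c ^ 3 * t j] times the measure of the superlevel set
    within the doubled ball.  The levels then reassemble into the integral of
    [u ^ (1 + delta)], hence of [K * G * u ^ delta], over the doubled ball,
    where the assumed inequality applies; the factor [2 ^ delta - 1] absorbs the
    constants. *)
Let valid_step Phi : (0 <= Phi)%R -> valid Phi -> valid (c ^+ 3 + Phi / 2).
Proof.
move=> Phi0 vPhi x0 r x r0 x0x; have [_ uN] := bu.
have c3 : (1 <= c ^+ 3)%R by rewrite exprn_ege1.
have c0 : (0 <= c)%R by exact: le_trans c_ge1.
pose a := (c ^+ 3 * u x)%R.
have a0 : (0 < a)%R by rewrite mulr_gt0//; lra.
have [J NJ] : exists J, (N <= a * 2 ^+ J)%R.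
  exists (Num.truncn (N / a)).+1.
  rewrite mulrC -ler_pdivrMr//; apply: (le_trans (ltW (truncnS_gt _))).
  by rewrite -natrX ler_nat ltnW// ltn_expl.
set kap := (2 `^ delta - 1)%R.
have kap0 : (0 <= kap)%R.
  by rewrite subr_ge0 -[leLHS](powRr0 2) ler_powR// ler1n.
pose t j := (a * 2 ^+ j)%R.
have t0 j : (0 < t j)%R by rewrite mulr_gt0// exprn_gt0.
pose L j := [set y | (t j < u y)%R].
have mL j : measurable (L j).
  by apply: (complete_Borel_open mu_Borel); exact: hl_superlevel_open bG.
have inL j y : (y \in L j) = (t j < u y)%R.
  by apply/idP/idP => [/set_mem//|?]; exact/mem_set.
have r20 : (0 < 2 * r)%R by rewrite mulr_gt0.
have x02 : ball x0 (2 * r)%R x by apply: le_ball x0x; lra.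
pose F j y := ((kap * t j `^ delta) * (G y * ((y \in L j) : nat)%:R))%R.
have F0 j y : (0 <= F j y)%R by rewrite !mulr_ge0 ?powR_ge0.
have mL1 j D : measurable_fun D (fun y => ((y \in L j) : nat)%:R : R).
  rewrite (_ : (fun y => _) = \1_(L j)); last first.
    by apply/funext => y; rewrite indicE.
  exact: measurable_indic.
have mF j D : measurable_fun D (F j).
  by apply: measurable_funM => //; apply: measurable_funM => //; exact: mL1.
pose B := ball x0 r; pose B2 := ball x0 (2 * r)%R.
have mBB : measurable B by exact: mB.
have mB2 : measurable B2 by exact: mB.
have split_le : \int[mu]_(y in B) (G y * u y `^ delta)%:E <=
    (a `^ delta)%:E * \int[mu]_(y in B) (G y)%:E
    + \sum_(j < J) (kap * t j `^ delta)%:E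
        * \int[mu]_(y in B `&` L j) (G y)%:E.
  have mGa : measurable_fun B (fun y => (a `^ delta * G y)%:E).
    by apply/measurable_EFinP; apply: measurable_funM.
  have Ga0 y : 0 <= (a `^ delta * G y)%:E.
    by rewrite lee_fin mulr_ge0// powR_ge0.
  apply: (@le_trans _ _ (\int[mu]_(y in B) ((a `^ delta * G y)%:E
      + \sum_(j < J) (F j y)%:E))).
    apply: ge0_le_integral => //.
    - by move=> y _; rewrite lee_fin mulr_ge0// powR_ge0.
    - by apply/measurable_EFinP; apply: measurable_funM.
    - apply: emeasurable_funD => //; apply: emeasurable_sum => j.
      by apply/measurable_EFinP; exact: mF.
    - move=> y _; rewrite sumEFin -EFinD lee_fin.
      rewrite mulrC; have /andP[uy0 uyN] := uN y.
      have uJ := powR_dyadic_le a0 uy0 delta0 (le_trans uyN NJ).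
      apply: le_trans (ler_wpM2r (G0 y) uJ) _.
      rewrite mulrDl lerD2l mulr_suml; apply: ler_sum => j _.
      by rewrite /F inL [(G y * _)%R]mulrC [leRHS]mulrA.
  rewrite ge0_integralD//; last 2 first.
  - by move=> y _; apply: sume_ge0 => j _; rewrite lee_fin.
  - by apply: emeasurable_sum => j; apply/measurable_EFinP; exact: mF.
  rewrite ge0_integral_sum//; last 2 first.
  - by move=> j; apply/measurable_EFinP; exact: mF.
  - by move=> j y _; rewrite lee_fin.
  apply: leeD.
    under eq_integral do rewrite EFinM.
    rewrite ge0_integralZl//; first by apply/measurable_EFinP.
    - by move=> y _; rewrite lee_fin.
    - by rewrite lee_fin powR_ge0.
  apply: lee_sum => j _; rewrite -integral_indicM//.
  under eq_integral do rewrite EFinM.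
  rewrite ge0_integralZl//.
  - by apply/measurable_EFinP; apply: measurable_funM => //; exact: mL1.
  - by move=> y _; rewrite lee_fin mulr_ge0.
  - by rewrite lee_fin mulr_ge0// powR_ge0.
apply: (le_trans split_le); rewrite mulrDl EFinD ge0_muleDl; last 2 first.
- by rewrite lee_fin !mulr_ge0 ?powR_ge0 ?exprn_ge0// ltW.
- by rewrite lee_fin !mulr_ge0 ?divr_ge0 ?powR_ge0// ltW.
apply: leeD.
  apply: (@le_trans _ _ ((a `^ delta)%:E * ((u x)%:E * mu B))).
    apply: lee_wpmul2l; first by rewrite lee_fin powR_ge0.
    exact: integral_le_hl bG r0 x0x.
  rewrite muleA -EFinM; apply: lee_wpmul2r => //; rewrite lee_fin mulrA.
  apply: ler_wpM2r; first exact: ltW.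
  rewrite powRM ?(ltW (u0 x))//; last by lra.
  by apply: ler_wpM2r; [exact: powR_ge0|apply: ler1_powR; case/andP: delta01].
have K0 : (0 < K)%R.
  by have := lt_le_trans (u0 x) (A1 x); rewrite pmulr_lgt0// (lt_le_trans eta0).
pose H j y :=
  ((kap * t j `^ delta * (c ^+ 3 * t j)) * ((y \in L j) : nat)%:R)%R.
have H0 j y : (0 <= H j y)%R.
  by rewrite !mulr_ge0 ?powR_ge0// ?exprn_ge0// ltW.
have mH j D : measurable_fun D (H j).
  by apply: measurable_funM => //; exact: mL1.
apply: (@le_trans _ _ (\int[mu]_(y in B2) \sum_(j < J) (H j y)%:E)).
  rewrite ge0_integral_sum//; last 2 first.
  - by move=> j; apply/measurable_EFinP; exact: mH.
  - by move=> j y _; rewrite lee_fin.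
  apply: lee_sum => j _; under eq_integral do rewrite EFinM.
  rewrite ge0_integralZl//; last 2 first.
  - by apply/measurable_EFinP; exact: mL1.
  - by rewrite lee_fin !mulr_ge0 ?powR_ge0// ?exprn_ge0// ltW.
  rewrite (_ : \int[mu]_(y in B2) _ = mu (B2 `&` L j)); last first.
    rewrite -[RHS]mul1e -integral_cst; last exact: measurableI.
    rewrite integral_mkcondr; apply: eq_integral => y _.
    by rewrite patchE; case: ifPn.
  rewrite (EFinM (kap * t j `^ delta)) -muleA; apply: lee_wpmul2l.
    by rewrite lee_fin mulr_ge0// powR_ge0.
  apply: (integral_level_set mu_Borel mu_ball c_ge1 mu_doubling bG r0 x0x)
    => //.
  by rewrite /t ler_peMr ?exprn_ege1 ?ler1n// ltW.
apply: (@le_trans _ _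
    (\int[mu]_(y in B2) ((2 * kap * c ^+ 3 * K)%:E * (G y * u y `^ delta)%:E))).
  apply: ge0_le_integral => //.
  - by move=> y _; apply: sume_ge0 => j _; rewrite lee_fin.
  - by apply: emeasurable_sum => j; apply/measurable_EFinP; exact: mH.
  - apply/measurable_EFinP; apply: measurable_funM => //.
    exact: measurable_funM.
  move=> y _; rewrite sumEFin -EFinM lee_fin.
  apply: (@le_trans _ _ (kap * c ^+ 3 * u y `^ delta *
      \sum_(j < J) t j * ((t j < u y)%R : nat)%:R)%R).
    rewrite mulr_sumr; apply: ler_sum => j _; rewrite /H inL.
    case: ltP => ty; last by rewrite !mulr0.
    have tu : (t j `^ delta <= u y `^ delta)%R.
      by apply: ge0_ler_powR; rewrite ?nnegrE// ltW.
    rewrite !mulr1 mulrA; apply: ler_wpM2r; first exact: ltW.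
    rewrite mulrAC; apply: ler_wpM2l => //.
    by rewrite mulr_ge0// exprn_ge0.
  apply: (@le_trans _ _ (kap * c ^+ 3 * u y `^ delta * (2 * (K * G y)))%R).
    apply: ler_wpM2l; first by rewrite !mulr_ge0 ?powR_ge0// exprn_ge0.
    apply: le_trans (sum_dyadic_le _ a0 (ltW (u0 y))) _.
    by rewrite ler_pM2l//; exact: A1.
  by rewrite le_eqVlt; apply/orP; left; apply/eqP; ring.
rewrite ge0_integralZl//; last 3 first.
- by apply/measurable_EFinP; apply: measurable_funM.
- by move=> y _; rewrite lee_fin mulr_ge0// powR_ge0.
- by rewrite lee_fin !mulr_ge0 ?exprn_ge0// ltW.
set v := (u x `^ delta * u x)%R.
have v0 : (0 <= v)%R by rewrite mulr_ge0 ?powR_ge0// ltW.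
have k0 : (0 <= 2 * kap * c ^+ 3 * K)%R by rewrite !mulr_ge0 ?exprn_ge0// ltW.
apply: (@le_trans _ _ ((2 * kap * c ^+ 3 * K)%:E *
    ((Phi * v)%:E * (c%:E * mu B)))).
  apply: lee_wpmul2l; first by rewrite lee_fin.
  apply: (le_trans (vPhi x0 _ x r20 x02)); apply: lee_wpmul2l.
    by rewrite lee_fin mulr_ge0.
  exact: mu_doubling.
rewrite !muleA -!EFinM; apply: lee_wpmul2r => //; rewrite lee_fin.
have : (2 * kap * c ^+ 3 * K * c <= 1 / 2)%R.
  by move: delta_small; rewrite -/kap !exprS expr0; nra.
move=> /(ler_wpM2l (mulr_ge0 Phi0 v0)); rewrite !exprS expr0; nra.
Qed.

(** The power in the integral is one of [hl mu G] because the layer-cake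
    decomposition has to run along sets every point of which lies in a ball of
    large average. *)
Lemma reverse_Holder x0 r x : (0 < r)%R -> ball x0 r x ->
  \int[mu]_(y in ball x0 r) (G y * hl mu G y `^ delta)%:E <=
    ((2 * c ^+ 3 + 1) * (hl mu G x `^ delta * hl mu G x))%:E * mu (ball x0 r).
Proof.
have c3 : (1 <= c ^+ 3)%R by rewrite exprn_ege1.
have iterate n : valid (2 * c ^+ 3 + (N / eta) `^ delta / 2 ^+ n)%R.
  elim: n => [|n IH].
    move=> x1 r1 x2 r10 x12; apply: le_trans (valid_init r10 x12) _.
    apply: lee_wpmul2r => //; rewrite lee_fin; apply: ler_wpM2r.
      by rewrite mulr_ge0 ?powR_ge0// ltW.
    by rewrite expr0 divr1 lerDr; lra.
  have P0 : (0 <= 2 * c ^+ 3 + (N / eta) `^ delta / 2 ^+ n)%R.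
    by rewrite addr_ge0 ?divr_ge0 ?powR_ge0 ?exprn_ge0//; lra.
  have := valid_step P0 IH; congr valid.
  by rewrite (exprS 2 n) invfM; field; rewrite expf_neq0.
have [n nN] : exists n, ((N / eta) `^ delta / 2 ^+ n <= 1)%R.
  exists (Num.truncn ((N / eta) `^ delta)).+1.
  rewrite ler_pdivrMr ?exprn_gt0// mul1r.
  apply: (le_trans (ltW (truncnS_gt _))).
  by rewrite -natrX ler_nat ltnW// ltn_expl.
move=> r0 x0x; apply: (le_trans (iterate n _ _ _ r0 x0x)).
apply: lee_wpmul2r => //; rewrite lee_fin; apply: ler_wpM2r.
  by rewrite mulr_ge0 ?powR_ge0// ltW.
by rewrite lerD2l.
Qed.

End reverse_Holder.

(** * The Rubio de Francia iteration *)

Section iteration.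
Context (d : measure_display) (R : realType) (X : metricMeasurableType d R).
Variable mu : {measure set X -> \bar R}.
Hypothesis mu_Borel : complete_Borel_measure mu.
Hypothesis mu_ball : balls_pos_finite mu.

Variables (N b : R) (h : X -> R).
Hypothesis bh : bounded_mfun N h.
Hypothesis b_bound : (0 < b <= 2^-1)%R.

Fixpoint maximal_iter n : X -> R :=
  if n is m.+1 then fun x => (h x + b * hl mu (maximal_iter m) x)%R
  else fun=> 0%R.

Let b0 : (0 < b)%R. Proof. by case/andP: b_bound. Qed.

Let N0 (x : X) : (0 <= N)%R.
Proof. by have [_ /(_ x)/andP[h0]] := bh; exact: le_trans. Qed.

Lemma bounded_maximal_iter n : bounded_mfun (2 * N) (maximal_iter n).
Proof.
elim: n => [|n IH].
  by split; [exact: measurable_cst|move=> x; rewrite lexx mulr_ge0// (N0 x)].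
have [mH HN] := bounded_hl mu_Borel mu_ball IH; have [mh hN] := bh.
split => [|x /=]; first by apply: measurable_funD => //; exact: measurable_funM.
have /andP[H0 H2N] := HN x; have /andP[h0 hxN] := hN x.
rewrite addr_ge0 ?mulr_ge0 ?(ltW b0)//=.
rewrite (_ : 2 * N = N + 2^-1 * (2 * N))%R; last by lra.
by apply: lerD => //; apply: ler_pM => //; [exact: ltW|case/andP: b_bound].
Qed.

Lemma maximal_iter_step n x :
  (maximal_iter n.+1 x <= maximal_iter n x + b ^+ n * N)%R.
Proof.
elim: n x => [|n IH] x.
  rewrite /= expr0 mul1r add0r; have [_ /(_ x)/andP[_ hN]] := bh.
  suff : (hl mu (fun=> 0) x <= 0)%R by move: b0 hN; nra.
  apply: (hl_le mu_Borel mu_ball (bounded_maximal_iter 0)) => z r r0 zx.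
  by rewrite integral0 mul0e.
rewrite [leLHS]/= [X in (_ <= X + _)%R]/= -addrA lerD2l exprS -mulrA -mulrDr.
apply: ler_wpM2l; first exact: ltW.
apply: (hl_le_addr mu_Borel mu_ball (bounded_maximal_iter n.+1)
  (bounded_maximal_iter n)) => //.
by rewrite mulr_ge0 ?(N0 x)// exprn_ge0// ltW.
Qed.

Lemma le_maximal_iter n x : (h x <= maximal_iter n.+1 x)%R.
Proof.
have [_ /(_ x)/andP[H0 _]] :=
  bounded_hl mu_Borel mu_ball (bounded_maximal_iter n).
by rewrite lerDl mulr_ge0// ltW.
Qed.

(** The constant [b ^ n * N] makes up for the increment from
    [maximal_iter n.+1] to [maximal_iter n.+2]; when it is positive, it also
    keeps the function away from zero, as [reverse_Holder] requires. *)
Lemma maximal_iter_A1 n x :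
  (hl mu (fun y => maximal_iter n.+1 y + b ^+ n * N) x
    <= (b^-1 + 1) * (maximal_iter n.+1 x + b ^+ n * N))%R.
Proof.
set eta := (b ^+ n * N)%R.
have eta0 : (0 <= eta)%R by rewrite mulr_ge0 ?(N0 x)// exprn_ge0// ltW.
have [mG GN] := bounded_maximal_iter n.+1.
have bE : bounded_mfun (2 * N + eta) (fun y => maximal_iter n.+1 y + eta)%R.
  split; first exact: measurable_funD.
  by move=> y; have /andP[G0 G2N] := GN y; rewrite addr_ge0//= lerD2r.
apply: le_trans
  (hl_le_addr mu_Borel mu_ball bE (bounded_maximal_iter n.+1) eta0 _ x) _.
  by move=> y.
have step :
    (b * hl mu (maximal_iter n.+1) x <= maximal_iter n.+1 x + b * eta)%R.
  apply: (@le_trans _ _ (maximal_iter n.+2 x)).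
    by rewrite lerDr; have [_ /(_ x)/andP[]] := bh.
  by rewrite (le_trans (maximal_iter_step n.+1 x))// exprS mulrA.
have {}step :
    (hl mu (maximal_iter n.+1) x <= b^-1 * maximal_iter n.+1 x + eta)%R.
  rewrite -(ler_pM2l b0); apply: (le_trans step).
  by rewrite mulrDr mulVKf// gt_eqF.
have binv : (1 <= b^-1)%R.
  by rewrite invf_ge1// (le_trans (proj2 (andP b_bound)))// invf_le1// ler1n.
have /andP[G0 _] := GN x.
rewrite mulrDr !mulrDl !mul1r; nra.
Qed.

End iteration.

Section pointwise_bound.
Context (d : measure_display) (R : realType) (X : metricMeasurableType d R).
Variable mu : {measure set X -> \bar R}.
Hypothesis mu_Borel : complete_Borel_measure mu.
Hypothesis mu_ball : balls_pos_finite mu.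
Variable c : R.
Hypothesis c_ge1 : (1 <= c)%R.
Hypothesis mu_doubling : doubling mu c.

Variables (N b delta : R) (h : X -> R).
Hypothesis N0 : (0 < N)%R.
Hypothesis bh : bounded_mfun N h.
Hypothesis b_bound : (0 < b <= 2^-1)%R.
Hypothesis delta01 : (0 < delta <= 1)%R.
Hypothesis delta_small :
  ((2 `^ delta - 1) * (4 * c ^+ 4 * (b^-1 + 1)) <= 1)%R.

(** Almost everywhere [h <= 4 * c ^ 3 * hl mu h], and both [h] and [hl mu h] are
    dominated by the corresponding functions of the A_1 weight [E], to which the
    reverse Hoelder inequality applies. *)
Lemma hl_powR_le_iter n x :
  (hl mu (fun y => h y * h y `^ delta) x <=
   (4 * c ^+ 3) `^ delta * (2 * c ^+ 3 + 1) * (b^-1 + 1) `^ (1 + delta)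
     * (maximal_iter mu b h n.+1 x + b ^+ n * N) `^ (1 + delta))%R.
Proof.
pose E y := (maximal_iter mu b h n.+1 y + b ^+ n * N)%R.
set eta := (b ^+ n * N)%R.
have b0 : (0 < b)%R by case/andP: b_bound.
have delta0 : (0 <= delta)%R by case/andP: delta01 => /ltW.
have eta0 : (0 < eta)%R by rewrite mulr_gt0// exprn_gt0.
have [mG GN] := bounded_maximal_iter mu_Borel mu_ball bh b_bound n.+1.
have E_ge y : (eta <= E y)%R by rewrite lerDr; have /andP[] := GN y.
have E0 y : (0 < E y)%R by exact: lt_le_trans (E_ge y).
have bE : bounded_mfun (2 * N + eta) E.
  split; first exact: measurable_funD.
  by move=> y; have /andP[G0 G2N] := GN y; rewrite ltW//= lerD2r.
have A1 y : (hl mu E y <= (b^-1 + 1) * E y)%R.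
  exact: maximal_iter_A1.
have [mh hN] := bh; have h0 y : (0 <= h y)%R by have /andP[] := hN y.
have [mHE HEN] := bounded_hl mu_Borel mu_ball bE.
have HE0 y : (0 <= hl mu E y)%R by have /andP[] := HEN y.
have mpow (D : set X) (g : X -> R) : measurable_fun setT g ->
    measurable_fun D (fun y => g y `^ delta)%R.
  move=> mg; apply: (measurableT_comp (measurable_powR _)) => //.
  exact: measurable_funTS.
have bf : bounded_mfun (N * N `^ delta) (fun y => h y * h y `^ delta)%R.
  split; first by apply: measurable_funM => //; exact: mpow.
  move=> y; have /andP[_ hyN] := hN y.
  rewrite mulr_ge0 ?powR_ge0//= ler_pM ?powR_ge0//.
  by apply: ge0_ler_powR; rewrite ?nnegrE// ltW.
have c30 : (0 <= 4 * c ^+ 3)%R.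
  by rewrite mulr_ge0// exprn_ge0// (le_trans _ c_ge1).
have hE y : (h y <= E y)%R.
  apply: (le_trans (le_maximal_iter mu_Borel mu_ball bh b_bound n y)).
  by rewrite lerDl ltW.
have ae_bound := ae_le_hl mu_Borel mu_ball c_ge1 mu_doubling x bh.
apply: (hl_le mu_Borel mu_ball bf) => z r r0 zx.
have mB : measurable (ball z r : set X) by exact: complete_Borel_ball.
have mEH : measurable_fun (ball z r) (fun y => E y * hl mu E y `^ delta)%R.
  by apply: measurable_funM; [apply: measurable_funTS; case: bE|exact: mpow].
apply: (@le_trans _ _ (\int[mu]_(y in ball z r)
    (((4 * c ^+ 3) `^ delta)%:E * (E y * hl mu E y `^ delta)%:E))).
  apply: ae_ge0_le_integral => //.
  - by move=> y _; rewrite lee_fin mulr_ge0// powR_ge0.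
  - by apply/measurable_EFinP; apply: measurable_funTS; case: bf.
  - by move=> y _; rewrite -EFinM lee_fin !mulr_ge0 ?powR_ge0// ltW.
  - by apply/measurable_EFinP; apply: measurable_funM.
  apply: filterS ae_bound => y hy _.
  rewrite -EFinM lee_fin mulrCA -powRM//.
  apply: ler_pM => //; first exact: powR_ge0.
  apply: ge0_ler_powR; rewrite ?nnegrE//; first by rewrite mulr_ge0.
  apply: (le_trans hy); apply: ler_wpM2l => //.
  exact: (le_hl mu_Borel mu_ball bh bE).
rewrite ge0_integralZl//; last 3 first.
- by apply/measurable_EFinP.
- by move=> y _; rewrite lee_fin mulr_ge0 ?powR_ge0// ltW.
- by rewrite lee_fin powR_ge0.
apply: (@le_trans _ _ (((4 * c ^+ 3) `^ delta)%:E *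
   (((2 * c ^+ 3 + 1) * (hl mu E x `^ delta * hl mu E x))%:E * mu (ball z r)))).
  apply: lee_wpmul2l; first by rewrite lee_fin powR_ge0.
  exact: (reverse_Holder mu_Borel mu_ball c_ge1 mu_doubling bE eta0 E_ge A1).
rewrite muleA -EFinM; apply: lee_wpmul2r => //; rewrite lee_fin -!mulrA.
apply: ler_wpM2l; first exact: powR_ge0.
apply: ler_wpM2l.
  by rewrite addr_ge0// mulr_ge0// exprn_ge0// (le_trans _ c_ge1).
have binv : (0 <= b^-1 + 1)%R by rewrite addr_ge0// invr_ge0 ltW.
rewrite -powRM ?(ltW (E0 x))// mulrC -[X in (X * _)%R]powRr1//.
rewrite -powRD; last by apply/implyP => /eqP; move: delta0; lra.
apply: ge0_ler_powR; rewrite ?nnegrE//; first by rewrite addr_ge0.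
by apply: mulr_ge0 => //; exact: ltW (E0 x).
Qed.

End pointwise_bound.

(** * Weighted integrals *)

Lemma powRD_le (R : realType) (x y p : R) : (0 <= x)%R -> (0 <= y)%R ->
  (0 <= p)%R -> ((x + y) `^ p <= 2 `^ p * (x `^ p + y `^ p))%R.
Proof.
move=> x0 y0 p0; wlog xy : x y x0 y0 / (x <= y)%R.
  move=> H; have [xy|/ltW yx] := leP x y; first exact: H.
  by rewrite addrC [(x `^ p + _)%R]addrC; exact: H.
apply: (@le_trans _ _ ((2 * y) `^ p)%R).
  by apply: ge0_ler_powR; rewrite ?nnegrE ?addr_ge0 ?mulr_ge0//; lra.
by rewrite powRM// ler_wpM2l ?powR_ge0// lerDr powR_ge0.
Qed.

Section weighted.
Context (d : measure_display) (R : realType) (X : metricMeasurableType d R).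
Variable mu : {measure set X -> \bar R}.
Hypothesis mu_Borel : complete_Borel_measure mu.
Hypothesis mu_ball : balls_pos_finite mu.
Variable c : R.
Hypothesis c_ge1 : (1 <= c)%R.
Hypothesis mu_doubling : doubling mu c.

Variables (p A : R) (W : X -> R).
Hypothesis p_ge1 : (1 <= p)%R.
Hypothesis A_ge1 : (1 <= A)%R.
Hypothesis mW : measurable_fun setT W.
Hypothesis W0 : forall x, (0 <= W x)%R.

Let wint (q : R) (g : X -> R) := \int[mu]_x (g x `^ q * W x)%:E.

Hypothesis hl_bounded : forall N g, bounded_mfun N g ->
  wint p (hl mu g) <= A%:E * wint p g.

(** With this choice [(2 * b) ^ p * A <= 1 / 2], so the contribution of the
    previous iterate to the next one is halved in [wint_maximal_iter]. *)
Let b : R := (4 * A)^-1%R.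

Let A0 : (0 < A)%R. Proof. exact: lt_le_trans A_ge1. Qed.

Let p0 : (0 <= p)%R. Proof. exact: le_trans p_ge1. Qed.

Let b_bound : (0 < b <= 2^-1)%R.
Proof.
rewrite /b invr_gt0 mulr_gt0//= lef_pV2 ?posrE ?mulr_gt0//.
by move: A_ge1; lra.
Qed.

Let mpowW (g : X -> R) (q : R) : measurable_fun setT g ->
  measurable_fun setT (fun x => (g x `^ q * W x)%:E).
Proof.
move=> mg; apply/measurable_EFinP; apply: measurable_funM => //.
exact: (measurableT_comp (measurable_powR _)).
Qed.

Let powW0 (g : X -> R) (q : R) x : 0 <= (g x `^ q * W x)%:E.
Proof. by rewrite lee_fin mulr_ge0// powR_ge0. Qed.

Lemma wint_maximal_iter N h n : bounded_mfun N h ->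
  wint p (maximal_iter mu b h n) <= (2 * 2 `^ p)%:E * wint p h.
Proof.
move=> bh; have [mh hN] := bh; have b0 : (0 < b)%R by case/andP: b_bound.
have p2 : (0 <= 2 * 2 `^ p :> R)%R by rewrite mulr_ge0 ?powR_ge0.
have I0 : 0 <= wint p h by apply: integral_ge0.
elim: n => [|n IH].
  rewrite /wint /= integral0_eq => [|x _]; last first.
    by rewrite powR0 ?mul0r// gt_eqF// (lt_le_trans _ p_ge1).
  by rewrite mule_ge0.
have bG := bounded_maximal_iter mu_Borel mu_ball bh b_bound n.
have [mH HN] := bounded_hl mu_Borel mu_ball bG.
set H := hl mu (maximal_iter mu b h n) in mH HN.
apply: (@le_trans _ _ (\int[mu]_x ((2 `^ p)%:E * (h x `^ p * W x)%:E
    + ((2 * b) `^ p)%:E * (H x `^ p * W x)%:E))).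
  apply: ge0_le_integral => //.
  - apply: mpowW.
    by have [] := bounded_maximal_iter mu_Borel mu_ball bh b_bound n.+1.
  - apply: emeasurable_funD; apply: measurable_funeM; exact: mpowW.
  move=> x _; rewrite -!EFinM -EFinD lee_fin !mulrA -mulrDl.
  apply: ler_wpM2r => //; have /andP[H0 _] := HN x; have /andP[h0 _] := hN x.
  apply: (le_trans (powRD_le h0 (mulr_ge0 (ltW b0) H0) p0)).
  rewrite mulrDr lerD2l (powRM p (ltW b0) H0).
  by rewrite (powRM p (ler0n R 2) (ltW b0)) mulrA.
rewrite ge0_integralD//; last 4 first.
- by move=> x _; rewrite mule_ge0// lee_fin powR_ge0.
- by apply: measurable_funeM; exact: mpowW.
- by move=> x _; rewrite mule_ge0// lee_fin powR_ge0.
- by apply: measurable_funeM; exact: mpowW.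
rewrite !ge0_integralZl//; last 3 first.
- exact: mpowW.
- by rewrite lee_fin powR_ge0.
- exact: mpowW.
have -> : (2 * 2 `^ p)%R = (2 `^ p + 2 `^ p :> R)%R by lra.
rewrite EFinD ge0_muleDl ?lee_fin ?powR_ge0//; apply: leeD => //.
apply: (@le_trans _ _
    (((2 * b) `^ p)%:E * (A%:E * ((2 * 2 `^ p)%:E * wint p h)))).
  apply: lee_wpmul2l; first by rewrite lee_fin powR_ge0.
  apply: le_trans (hl_bounded bG) _; apply: lee_wpmul2l => //.
  by rewrite lee_fin ltW.
rewrite !muleA -!EFinM; apply: lee_wpmul2r => //; rewrite lee_fin.
have A2 : (0 < (2 * A)^-1 <= 1)%R.
  rewrite invr_gt0 mulr_gt0//= invf_le1 ?mulr_gt0//.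
  by move: A_ge1; lra.
have -> : (2 * b = (2 * A)^-1)%R.
  by rewrite /b; field; rewrite gt_eqF.
have le2 := ge1r_powR A2 p_ge1.
have AA : ((2 * A)^-1 * A = 2^-1)%R by field; rewrite gt_eqF.
have : ((2 * A)^-1 `^ p * A <= 2^-1)%R by rewrite -AA ler_pM2r.
move=> /(ler_wpM2r p2); rewrite mulKf//.
Qed.

(** Let [f = h * h ^ delta], [eta n = b ^ n * N], and let [G] be the iterate of
    index [n + 1].  Where [hl mu f] exceeds [C * (2 * eta n) ^ (1 + delta)], the
    pointwise bound [hl mu f <= C * (G + eta n) ^ (1 + delta)] forces
    [eta n <= G], hence [hl mu f <= C * (2 * G) ^ (1 + delta)], and the constant
    [eta n], whose power need not be integrable, is gone.  These sets increase
    to the set where [hl mu f] is positive. *)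
Lemma wint_hl_le N h delta q : (0 < N)%R -> bounded_mfun N h ->
  (0 < delta <= 1)%R -> (0 < q)%R -> ((1 + delta) * q = p)%R ->
  ((2 `^ delta - 1) * (4 * c ^+ 4 * (b^-1 + 1)) <= 1)%R ->
  wint q (hl mu (fun y => h y * h y `^ delta)%R) <=
    ((((4 * c ^+ 3) `^ delta * (2 * c ^+ 3 + 1)
        * (b^-1 + 1) `^ (1 + delta)) `^ q * 2 `^ p)
      * (2 * 2 `^ p))%:E * wint p h.
Proof.
move=> N0 bh delta01 q0 dq small.
set C :=
  ((4 * c ^+ 3) `^ delta * (2 * c ^+ 3 + 1) * (b^-1 + 1) `^ (1 + delta))%R.
have b0 : (0 < b)%R by case/andP: b_bound.
have delta0 : (0 < delta)%R by case/andP: delta01.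
have c3 : (1 <= c ^+ 3)%R by rewrite exprn_ege1.
have C0 : (0 < C)%R.
  rewrite !mulr_gt0 ?powR_gt0//; first by lra.
    by lra.
  by rewrite addr_gt0// invr_gt0.
set T := hl mu _.
have [mh hN] := bh; have h0 y : (0 <= h y)%R by have /andP[] := hN y.
have bf : bounded_mfun (N * N `^ delta) (fun y => h y * h y `^ delta)%R.
  split.
    apply: measurable_funM => //.
    exact: (measurableT_comp (measurable_powR _)).
  move=> y; have /andP[_ hyN] := hN y.
  rewrite mulr_ge0 ?powR_ge0//= ler_pM ?powR_ge0//.
  by apply: ge0_ler_powR; rewrite ?nnegrE// ltW.
have [mT TN] := bounded_hl mu_Borel mu_ball bf.
have T0 x : (0 <= T x)%R by have /andP[] := TN x.
have T_le n x := hl_powR_le_iter mu_Borel mu_ball c_ge1 mu_doubling N0 bh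
  b_bound delta01 small n x.
pose eta n := (b ^+ n * N)%R.
have eta0 n : (0 < eta n)%R by rewrite mulr_gt0// exprn_gt0.
pose E n := [set x | (C * (2 * eta n) `^ (1 + delta) < T x)%R].
have d1 : (0 <= 1 + delta)%R by rewrite addr_ge0// ltW.
have eta_le m n : (m <= n)%N -> (eta n <= eta m)%R.
  move=> mn; rewrite ler_pM2r//; apply: ler_wiXn2l => //; first exact: ltW.
  by case/andP: b_bound => _; lra.
have ndE : {homo E : m n / (m <= n)%N >-> (m <= n)%O}.
  move=> m n mn; apply/subsetPset => x; apply: le_lt_trans.
  have e2 k : (0 <= 2 * eta k)%R by rewrite mulr_ge0// ltW.
  rewrite ler_pM2l//; apply: ge0_ler_powR; rewrite ?nnegrE//.
  by rewrite ler_pM2l//; exact: eta_le.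
have mE n : measurable (E n).
  by apply: (complete_Borel_open mu_Borel); exact: hl_superlevel_open bf.
have ET x : (0 < T x)%R -> exists n, E n x.
  move=> Tx.
  pose s := Num.min 1%R (T x / (2 * C))%R.
  have s0 : (0 < s)%R by rewrite lt_min ltr01 divr_gt0// mulr_gt0.
  have [n ns] : exists n, (2 * eta n <= s)%R.
    exists (Num.truncn (2 * N / s)).
    have ltn := truncnS_gt (2 * N / s)%R; set n := Num.truncn _ in ltn *.
    have bn : (b ^+ n <= 2^-1 ^+ n)%R.
      have /andP[_ b2] := b_bound.
      by apply: lerXn2r => //; rewrite nnegrE ?(ltW b0)// invr_ge0.
    have n2 : (n.+1%:R <= 2 ^+ n :> R)%R by rewrite -natrX ler_nat ltn_expl.
    apply: (@le_trans _ _ (2 * (2^-1 ^+ n * N))%R).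
      by rewrite ler_pM2l// ler_pM2r.
    rewrite exprVn mulrCA ler_pdivrMl ?exprn_gt0//.
    move: ltn; rewrite ltr_pdivrMr// => /ltW/le_trans; apply.
    by rewrite ler_pM2r.
  exists n; rewrite /E /=.
  have n01 : (0 < 2 * eta n <= 1)%R.
    by rewrite mulr_gt0//=; apply: (le_trans ns); rewrite ge_min lexx.
  have d11 : (1 <= 1 + delta)%R by rewrite lerDl ltW.
  apply: (@le_lt_trans _ _ (C * s)%R).
    by rewrite ler_pM2l//; apply: le_trans ns; exact: ge1r_powR.
  apply: (@le_lt_trans _ _ (C * (T x / (2 * C)))%R).
    by rewrite ler_pM2l// ge_min lexx orbT.
  have -> : (C * (T x / (2 * C)) = T x / 2)%R by field; rewrite gt_eqF.
  by rewrite ltr_pdivrMr// ltr_pMr// ltr1n.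
have bound n : \int[mu]_(x in E n) (T x `^ q * W x)%:E <=
    ((C `^ q * 2 `^ p)
      * (2 * 2 `^ p))%:E * wint p h.
  have bG := bounded_maximal_iter mu_Borel mu_ball bh b_bound n.+1.
  have [mG GN] := bG.
  apply: (@le_trans _ _ (\int[mu]_(x in E n)
     ((C `^ q * 2 `^ p)%:E * (maximal_iter mu b h n.+1 x `^ p * W x)%:E))).
    apply: ge0_le_integral => //.
    - by apply: measurable_funTS; exact: mpowW.
    - by apply: measurable_funTS; apply: measurable_funeM; exact: mpowW.
    move=> x Ex; rewrite -EFinM lee_fin mulrA; apply: ler_wpM2r => //.
    have /andP[G0 _] := GN x; set G := maximal_iter _ _ _ _ _ in G0 *.
    have Tle : (T x <= C * (G + eta n) `^ (1 + delta))%R by exact: T_le.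
    have Geta : (eta n <= G)%R.
      rewrite leNgt; apply/negP => Glt; move: Ex; rewrite /E /= ltNge => /negP.
      apply; apply: (le_trans Tle); rewrite ler_pM2l//.
      by apply: ge0_ler_powR; rewrite ?nnegrE//; have := eta0 n; lra.
    have Tle2 : (T x <= C * (2 * G) `^ (1 + delta))%R.
      apply: (le_trans Tle); rewrite ler_pM2l//.
      by apply: ge0_ler_powR; rewrite ?nnegrE//; have := eta0 n; lra.
    apply: (@le_trans _ _ ((C * (2 * G) `^ (1 + delta)) `^ q)%R).
      apply: ge0_ler_powR; rewrite ?nnegrE ?(ltW q0)//.
      by rewrite mulr_ge0 ?powR_ge0// ltW.
    by rewrite powRM ?powR_ge0 ?(ltW C0)// -powRrM dq powRM// mulrA.
  rewrite (EFinM (C `^ q * 2 `^ p)) -muleA.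
  apply: (@le_trans _ _
      ((C `^ q * 2 `^ p)%:E * wint p (maximal_iter mu b h n.+1))).
    rewrite -ge0_integralZl//; last 2 first.
    - exact: mpowW.
    - by rewrite lee_fin mulr_ge0 ?powR_ge0.
    apply: ge0_subset_integral => //.
      by apply: measurable_funeM; exact: mpowW.
    by move=> x _; rewrite mule_ge0// lee_fin mulr_ge0 ?powR_ge0.
  apply: lee_wpmul2l; first by rewrite lee_fin mulr_ge0 ?powR_ge0.
  exact: wint_maximal_iter bh.
have -> : wint q T = \int[mu]_(x in \bigcup_n E n) (T x `^ q * W x)%:E.
  rewrite [RHS]integral_mkcond; apply: eq_integral => x _; rewrite patchE.
  case: ifPn => // /negP xE; have : T x = 0%R.
    apply/eqP; rewrite eq_le T0 andbT leNgt; apply/negP => /ET[n Enx].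
    by apply: xE; apply/mem_set; exists n.
  by move=> ->; rewrite powR0 ?mul0r// gt_eqF.
have cvgE : \int[mu]_(x in E n) (T x `^ q * W x)%:E @[n --> \oo]
    --> \int[mu]_(x in \bigcup_n E n) (T x `^ q * W x)%:E.
  apply: ge0_nondecreasing_set_cvg_integral => // n.
  by apply: measurable_funTS; exact: mpowW.
apply: cvge_le cvgE; near=> n; exact: bound.
Unshelve. all: by end_near. Qed.

End weighted.

(** * Reduction to bounded functions *)

Section reduction.
Context (d : measure_display) (R : realType) (X : metricMeasurableType d R).
Variable mu : {measure set X -> \bar R}.
Hypothesis mu_Borel : complete_Borel_measure mu.
Hypothesis mu_ball : balls_pos_finite mu.

Lemma noncentered_maximal_ae (f g : X -> R) :
  measurable_fun setT f -> measurable_fun setT g ->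
  {ae mu, forall x, f x = g x} ->
  noncentered_maximal mu f = noncentered_maximal mu g.
Proof.
move=> mf mg fg; apply/funext => x; rewrite /noncentered_maximal.
suff avgE z r : average mu f (ball z r) = average mu g (ball z r).
  by congr ereal_sup; apply/seteqP; split => _ [z [r [r0 zx ->]]];
    exists z, r; rewrite avgE.
rewrite /average; congr (_ * _); apply: ae_eq_integral.
- exact: complete_Borel_ball.
- apply/measurable_EFinP; apply: measurableT_comp => //.
  exact: measurable_funTS.
- apply/measurable_EFinP; apply: measurableT_comp => //.
  exact: measurable_funTS.
- by apply: filterS fg => y fgy _; rewrite fgy.
Qed.

Lemma Lfun_infty_bounded (f : X -> R) : (forall x, (0 <= f x)%R) ->
  f \in Lfun mu +oo ->
  measurable_fun setT f /\ exists2 N : R, (0 < N)%R &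
    {ae mu, forall x, (f x <= N)%R}.
Proof.
move=> f0 /andP[/set_mem mf /set_mem]; rewrite /= /finite_norm unlock.
case: ifPn => [_ fin|]; last first.
  rewrite -leNgt measure_le0 => /eqP muT _; split => //; exists 1%R => //.
  by exists setT; split.
split => //.
have [M fM] : exists M : R, \forall x \ae mu, (`|f x| <= M)%R.
  exact: ess_sup_inf.ess_supr_bounded fin.
exists (`|M| + 1)%R; first by rewrite ltr_wpDl.
apply: filterS fM => x; rewrite ger0_norm// => fM.
by rewrite (le_trans fM)// (le_trans (ler_norm _))// lerDl.
Qed.

End reduction.

(** * Self-improvement *)

Unset Implicit Arguments.

Theorem lemma5p6 (R : realType) (cmu p C1 : R)
    (cmu_gt1 : (1 < cmu)%R) (p_gt1 : (1 < p)%R) :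
  exists eps C : R, (0 < eps < p - 1)%R /\
    forall (d : measure_display) (X : metricMeasurableType d R)
      (mu : {measure set X -> \bar R}) (w : X -> R),
      (exists x y : X, x <> y) ->
      complete_Borel_measure mu ->
      balls_pos_finite mu ->
      doubling mu cmu ->
      weight mu w ->
      (forall f : X -> R, weighted_Lp mu w p f ->
        \int[mu]_x (noncentered_maximal mu f x `^ p * (w x)%:E)
          <= C1%:E * \int[mu]_x (`|f x| `^ p * w x)%:E) ->
      forall f : X -> R,
        (forall x : X, (0 <= f x)%R) ->
        f \in Lfun mu +oo ->
        bounded_support f ->
        \int[mu]_x (noncentered_maximal mu f x `^ (p - eps) * (w x)%:E)
          <= C%:E * \int[mu]_x (f x `^ (p - eps) * w x)%:E.
Proof.
have c1 : (1 <= cmu)%R by exact: ltW.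
have p_ge1 : (1 <= p)%R by exact: ltW.
pose A := Num.max C1 1%R.
have A1 : (1 <= A)%R by rewrite le_max lexx orbT.
have A0 : (0 < A)%R by exact: lt_le_trans A1.
pose K := (((4 * A)^-1)^-1 + 1)%R.
have K0 : (0 < K)%R by rewrite /K invrK addr_gt0// mulr_gt0.
have c40 : (0 < 4 * cmu ^+ 4 * K)%R.
  by rewrite !mulr_gt0 ?exprn_gt0// (lt_trans _ cmu_gt1).
pose kap := ((4 * cmu ^+ 4 * K)^-1)%R.
have kap0 : (0 < kap)%R by rewrite invr_gt0.
have ln2 : (0 < ln 2 :> R)%R by rewrite ln_gt0// ltr1n.
have lnk : (0 < ln (1 + kap))%R by rewrite ln_gt0// ltrDl.
(* The three bounds ensure [delta <= 1], [1 < q], and [2 ^ delta <= 1 + kap],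
   which is the smallness required by the reverse Hoelder inequality. *)
pose delta := Num.min (Num.min 1%R ((p - 1) / 2)%R) (ln (1 + kap) / ln 2)%R.
have delta0 : (0 < delta)%R.
  by rewrite !lt_min ltr01 !divr_gt0// subr_gt0.
have delta1 : (delta <= 1)%R by rewrite !ge_min lexx.
have deltap : (delta <= (p - 1) / 2)%R by rewrite !ge_min lexx orbT.
have deltak : (delta <= ln (1 + kap) / ln 2)%R by rewrite ge_min lexx orbT.
have small : ((2 `^ delta - 1) * (4 * cmu ^+ 4 * K) <= 1)%R.
  rewrite -ler_pdivlMr// div1r lerBlDl.
  apply: (@le_trans _ _ (2 `^ (ln (1 + kap) / ln 2))%R).
    by rewrite ler_powR// ler1n.
  rewrite /powR pnatr_eq0 /= -mulrA mulVf ?gt_eqF// mulr1 lnK//.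
  by rewrite posrE addr_gt0.
pose q := (p / (1 + delta))%R.
have d10 : (0 < 1 + delta)%R by rewrite addr_gt0.
have dq : ((1 + delta) * q = p)%R by rewrite /q mulrC divfK// gt_eqF.
have q1 : (1 < q)%R by rewrite ltr_pdivlMr// mul1r; lra.
have q0 : (0 < q)%R by exact: lt_trans q1.
have qp : (q < p)%R by rewrite -dq ltr_pMl// ltrDl.
pose C := ((((4 * cmu ^+ 3) `^ delta * (2 * cmu ^+ 3 + 1)
      * K `^ (1 + delta)) `^ q * 2 `^ p) * (2 * 2 `^ p))%R.
exists (p - q)%R, C; split; first by apply/andP; split; lra.
move=> d X mu w _ mu_Borel mu_ball mu_doubling [mw _ w_pos] hl_w f f0 fL _.
rewrite (_ : p - (p - q) = q)%R; last by lra.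
have [mf [N N0 fN]] := Lfun_infty_bounded f0 fL.
(* [w] may be negative on a null set. *)
pose W x := Num.max (w x) 0%R.
have mW : measurable_fun setT W by exact: measurable_maxr.
have W0 x : (0 <= W x)%R by rewrite le_max lexx orbT.
have wW : {ae mu, forall x, w x = W x}.
  by apply: filterS w_pos => x wx; rewrite /W max_l// ltW.
have mpow (g v : X -> R) s : measurable_fun setT g -> measurable_fun setT v ->
    measurable_fun setT (fun x => (g x `^ s * v x)%:E).
  move=> mg mv; apply/measurable_EFinP; apply: measurable_funM => //.
  exact: (measurableT_comp (measurable_powR _)).
have intW (g : X -> R) s : measurable_fun setT g ->
    \int[mu]_x (g x `^ s * w x)%:E = \int[mu]_x (g x `^ s * W x)%:E.
  move=> mg; apply: ae_eq_integral => //; [exact: mpow|exact: mpow|].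
  by apply: filterS wW => x ->.
have maxW M (g : X -> R) s : bounded_mfun M g ->
    \int[mu]_x (noncentered_maximal mu g x `^ s * (w x)%:E) =
    \int[mu]_x (hl mu g x `^ s * W x)%:E.
  move=> bg; rewrite -intW; last by have [] := bounded_hl mu_Borel mu_ball bg.
  apply: eq_integral => x _; have [-> _] := hlE mu_Borel mu_ball x bg.
  by rewrite poweR_EFin EFinM.
have hl_W M (g : X -> R) : bounded_mfun M g ->
    \int[mu]_x (hl mu g x `^ p * W x)%:E <=
    A%:E * \int[mu]_x (g x `^ p * W x)%:E.
  move=> bg; have [mg gM] := bg.
  have gE x : `|g x|%R = g x by rewrite ger0_norm//; have /andP[] := gM x.
  have normE : \int[mu]_x (`|g x| `^ p * w x)%:E =
      \int[mu]_x (g x `^ p * W x)%:E.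
    by rewrite -intW//; apply: eq_integral => x _; rewrite gE.
  have I0 : 0 <= \int[mu]_x (g x `^ p * W x)%:E.
    by apply: integral_ge0 => x _; rewrite lee_fin mulr_ge0// powR_ge0.
  have [Ioo|] := ltP (\int[mu]_x (g x `^ p * W x)%:E) +oo; last first.
    rewrite leye_eq => /eqP ->; rewrite gt0_muley ?lte_fin//.
    exact: leey.
  rewrite -(maxW _ _ _ bg); apply: le_trans (hl_w g _) _.
    by split => //; rewrite normE.
  rewrite normE; apply: lee_wpmul2r => //.
  by rewrite lee_fin le_max lexx.
(* [f] may exceed its essential bound [N] on a null set. *)
pose h x := ((Num.min (f x) N) `^ (1 + delta)^-1)%R.
pose f' x := (h x * h x `^ delta)%R.
have f'E x : f' x = Num.min (f x) N.
  have m0 : (0 <= Num.min (f x) N)%R by rewrite le_min f0 ltW.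
  rewrite /f' /h -powRrM.
  have [->|mn0] := eqVneq (Num.min (f x) N) 0%R.
    by rewrite powR0 ?mul0r// invr_eq0 gt_eqF.
  rewrite -powRD ?mn0 ?implybT//.
  by rewrite -{1}[((1 + delta)^-1)%R]mulr1 -mulrDr mulVf ?gt_eqF// powRr1.
have bh : bounded_mfun (N `^ (1 + delta)^-1) h.
  split.
    apply: (measurableT_comp (measurable_powR _)) => //.
    exact: measurable_minr.
  move=> x; rewrite powR_ge0 /=; apply: ge0_ler_powR.
  - by rewrite invr_ge0 ltW.
  - by rewrite nnegrE le_min f0 ltW.
  - by rewrite nnegrE ltW.
  - by rewrite ge_min lexx orbT.
have bf' : bounded_mfun N f'.
  split; last by move=> x; rewrite f'E le_min f0 ltW//= ge_min lexx orbT.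
  rewrite (_ : f' = fun x => Num.min (f x) N); last exact/funext.
  exact: measurable_minr.
have ff' : {ae mu, forall x, f x = f' x}.
  by apply: filterS fN => x fxN; rewrite f'E min_l.
have [mf' _] := bf'.
rewrite (noncentered_maximal_ae mu_Borel mf mf' ff') (maxW _ _ _ bf') intW//.
have -> : \int[mu]_x (f x `^ q * W x)%:E = \int[mu]_x (h x `^ p * W x)%:E.
  apply: ae_eq_integral => //; [exact: mpow|by apply: mpow => //; case: bh|].
  apply: filterS ff' => x ffx _; congr (_ * _)%:E.
  by rewrite ffx f'E /h -powRrM; congr (_ `^ _)%R; rewrite /q mulrC.
apply: (wint_hl_le mu_Borel mu_ball c1 mu_doubling p_ge1 A1 mW W0 hl_W _ bh)
  => //.
- by rewrite powR_gt0.
- by rewrite delta0.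
Qed.
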